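(* Let $H:\mathbb R_+\to(0,1)$ be continuous and satisfy: (H1) there are constants $0<h_1<h_2<1$ with $h_1\le H_t\le h_2$ for all $t\ge0$; (H2) there are constants $D>0$, $\kappa\in(0,1]$ with $|H_t-H_s|\le D|t-s|^\kappa$ for all $t\ge s>0$. Let $Y$ be the multifractional Brownian motion with Hurst function $H$ and put $h_3=\min\{h_1,\kappa\}$. Then for any $\varepsilon>0$ and any $p>2$ there exists a nonnegative random variable $\eta=\eta(\varepsilon,p)$ such that almost surely, for all $0\le t_2<t_1\le t_2+1$, \[ |Y(t_1)-Y(t_2)|\le (t_1^{h_2+\varepsilon}\vee1)(t_1-t_2)^{h_3}\big(|\log(t_1-t_2)|^p\vee1\big)\eta, \] and there exist positive constants $C_1=C_1(\varepsilon,p)$, $C_2=C_2(\varepsilon,p)$ with $\mathbb P(\eta>u)\le C_1e^{-C_2u^2}$ for all $u>0$.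
   Context: The (harmonizable) multifractional Brownian motion with continuous functional parameter $H$ is $Y(t)=\int_{\mathbb R}\frac{e^{itu}-1}{|u|^{H_t+1/2}}\widetilde W(du)$, $t\ge0$, where $\widetilde W$ is the Fourier transform of real Gaussian white noise $W$, i.e. the unique complex-valued random measure with $\int_{\mathbb R}f(u)W(du)=\int_{\mathbb R}\widehat f(u)\widetilde W(du)$ a.s. for all $f\in L^2(\mathbb R)$.
   Formalization: Y is taken to be a version of the multifractional Brownian motion with almost surely continuous paths on [0,∞); the defining integral fixes each Y(t) only up to null sets, and the pathwise bound fails for arbitrary versions. *)

(* Defs.v *)
From HB Require Import structures.
From mathcomp Require Import all_boot all_order all_algebra.
From mathcomp Require Import all_classical all_reals all_analysis.
Set Implicit Arguments. Unset Strict Implicit. Unset Printing Implicit Defensive.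
Import Order.TTheory GRing.Theory Num.Theory.
Import numFieldNormedType.Exports.
Local Open Scope classical_set_scope.
Local Open Scope ring_scope.

Definition centered_gaussian d (T : measurableType d) (R : realType)
    (P : probability T R) (X : T -> R) : Prop :=
  measurable_fun setT X /\
  ((exists s : R, 0 < s /\
     forall A : set R, measurable A -> P (X @^-1` A) = normal_prob 0 s A)
   \/ {ae P, forall w, X w = 0}).

(* Real part of (e^{itu}-1) * conj(e^{isu}-1) / |u|^{H_t+H_s+1}:
   the integrand of the covariance E[Y(t)Y(s)] of the harmonizable mBm,
   obtained from the isometry of the Fourier-transformed white noise. *)
Definition mbm_kernel (R : realType) (H : R -> R) (t s u : R) : R :=
  ((cos (t * u) - 1) * (cos (s * u) - 1) + sin (t * u) * sin (s * u))
  / (`|u| `^ (H t + H s + 1)).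

(* Y is (a continuous version of) the harmonizable multifractional Brownian
   motion with functional parameter H, indexed by t >= 0: a centered jointly
   Gaussian process with covariance
     E[Y(t)Y(s)] = int_R (e^{itu}-1)(e^{-isu}-1)/|u|^{H_t+H_s+1} du,
   with almost surely continuous sample paths on [0, +oo). *)
Definition is_harmonizable_mBm d (T : measurableType d) (R : realType)
    (P : probability T R) (H : R -> R) (Y : R -> T -> R) : Prop :=
  (forall (n : nat) (t : 'I_n -> R) (c : 'I_n -> R),
      (forall i, 0 <= t i) ->
      centered_gaussian P (fun w => \sum_(i < n) c i * Y (t i) w)) /\
  (forall t s : R, 0 <= t -> 0 <= s ->
      ('E_P[Y t \* Y s] =
       \int[@lebesgue_measure R]_(u in setT) (mbm_kernel H t s u)%:E)%E) /\
  {ae P, forall w, {within [set t : R | 0 <= t], continuous (fun t => Y t w)}}.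

(* Main.v *)
Require Import Defs.
From HB Require Import structures.
From mathcomp Require Import all_boot all_order all_algebra.
From mathcomp Require Import all_classical all_reals all_analysis.
From mathcomp Require Import measurable_realfun.
From mathcomp Require Import ring lra.
Import Order.TTheory GRing.Theory Num.Theory.
Import numFieldNormedType.Exports.
Import HBNNSimple.
Local Open Scope classical_set_scope.
Local Open Scope ring_scope.

(** Idea.  Under (H1)-(H2) an increment of [Y] over [[s, t]], [t <= s + 1], is
    a centered Gaussian of variance at most
    [C * (max t 1 `^ (h2 + e) * (t - s) `^ h3) ^ 2] for every small [e > 0]:
    one splits the Fourier kernel into the part coming from [t - s] and the part
    coming from [H t - H s], and uses
    [\int min ((m u)^2) 1 / |u|^(2a+1) du <= C m^(2a)].
    A centered Gaussian [X] with [E X^2 <= V] satisfies [E exp (X^2 / 8V) <= 2], so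
    a single weighted series of such exponentials over all dyadic increments,
    having finite expectation, controls them all at once; its logarithm is
    [eta^2] up to constants, and Markov's inequality gives the Gaussian tail.
    The weights only cost a factor [n+1] at scale [2^-n], which is absorbed by
    [|log|^p], and a power [max t 1 `^ (eps - e)].  Chaining along dyadic
    approximations and path continuity carry the bound to all times. *)

(** * Exponential moments of centered Gaussians *)

(** Change of variables to the law of [X], whose density is [g]. It holds for simple functions by
    linearity over their fibres, and passes to [f] by monotone convergence. *)
Lemma ge0_integral_density d (T : measurableType d) (R : realType)
    (P : {measure set T -> \bar R}) (X : T -> R) (g : R -> R) (f : R -> \bar R) :
  measurable_fun setT X -> measurable_fun setT g -> (forall x, 0 <= g x) ->
  (forall A : set R, measurable A ->
     P (X @^-1` A) = (\int[lebesgue_measure]_(x in A) (g x)%:E)%E) ->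
  measurable_fun setT f -> (forall x, (0 <= f x)%E) ->
  (\int[P]_w f (X w) = \int[lebesgue_measure]_x (f x * (g x)%:E))%E.
Proof.
move=> mX mg g0 PX mf f0.
have simple (h : {nnsfun R >-> R}) :
    (\int[P]_w (h (X w))%:E = \int[lebesgue_measure]_x ((h x)%:E * (g x)%:E))%E.
  under [LHS]eq_integral do rewrite fimfunE -fsumEFin//.
  rewrite [LHS]ge0_integral_fsum//; last 2 first.
    - move=> r; apply/measurable_EFinP/measurable_funM => //.
      exact: measurableT_comp.
    - by move=> n x _; rewrite EFinM nnfun_muleindic_ge0.
  under [RHS]eq_integral.
    move=> x _; rewrite fimfunE -fsumEFin//.
    rewrite ge0_mule_fsuml; last by move=> r; rewrite EFinM nnfun_muleindic_ge0.
    over.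
  rewrite [RHS]ge0_integral_fsum//; last 2 first.
    - move=> r; refine (@emeasurable_funM _ _ R setT
        (fun x => (r * \1_(h @^-1` [set r]) x)%:E) (fun x => (g x)%:E) _ _);
        apply/measurable_EFinP => //.
      exact: measurable_funM.
    - by move=> r x _; rewrite EFinM mule_ge0 ?nnfun_muleindic_ge0 ?lee_fin.
  apply: eq_fsbigr => r /[!inE] -[y _ <-].
  under eq_integral do rewrite EFinM.
  under [RHS]eq_integral do rewrite EFinM -muleA.
  rewrite !ge0_integralZl//; last 5 first.
    - refine (@emeasurable_funM _ _ R setT
        (fun x => (\1_(h @^-1` [set h y]) x)%:E) (fun x => (g x)%:E) _ _);
        exact/measurable_EFinP.
    - by move=> x _; rewrite mule_ge0 ?lee_fin.
    - by rewrite lee_fin.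
    - by apply/measurable_EFinP/measurableT_comp.
    - by rewrite lee_fin.
  congr (_ * _)%E.
  rewrite -[LHS]/(\int[P]_x (\1_(X @^-1` (h @^-1` [set h y])) x)%:E)%E.
  rewrite integral_indic ?setIT//; last by rewrite -[X in measurable X]setTI; exact: mX.
  rewrite PX// [LHS]integral_mkcond; apply: eq_integral => x _.
  by rewrite epatch_indic muleC.
pose h := nnsfun_approx measurableT mf.
transitivity (limn (fun n => \int[P]_w (h n (X w))%:E)%E).
  rewrite -monotone_convergence//=.
  - by apply: eq_integral => w _; apply/esym/cvg_lim => //; exact: cvg_nnsfun_approx.
  - by move=> n; apply/measurable_EFinP/measurableT_comp.
  - by move=> n w _; rewrite lee_fin.
  - by move=> w _ m n mn; rewrite lee_fin; exact/lefP/nd_nnsfun_approx.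
under eq_fun do rewrite simple.
rewrite -monotone_convergence//=.
- apply: eq_integral => x _; apply/cvg_lim => //.
  by apply: cvgeZr => //; exact: cvg_nnsfun_approx.
- move=> n; refine (@emeasurable_funM _ _ R setT (fun x => (h n x)%:E)
    (fun x => (g x)%:E) _ _); exact/measurable_EFinP.
- by move=> n x _; rewrite mule_ge0 ?lee_fin.
- move=> x _ m n mn; rewrite lee_wpmul2r ?lee_fin//.
  by have /lefP := nd_nnsfun_approx measurableT mf mn; apply.
Qed.

(** An exponential tilt of a Gaussian density is again Gaussian: the exponents add up to
    [- x^2 / (2 (c s)^2)], and the factor [c] restores the peak. *)
Lemma normal_pdf_expR (R : realType) (s c x : R) : 0 < s -> 0 < c ->
  expR (x ^+ 2 / (2 * s ^+ 2) * (1 - c ^- 2)) * normal_pdf 0 s x =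
  c * normal_pdf 0 (c * s) x.
Proof.
move=> s0 c0; have cs0 : 0 < c * s by rewrite mulr_gt0.
rewrite !normal_pdfE ?gt_eqF// /normal_peak /normal_fun !subr0 mulrCA -expRD [RHS]mulrA.
congr (_ * _); last by congr expR; field; lra.
rewrite (_ : (c * s) ^+ 2 * pi *+ 2 = c ^+ 2 * (s ^+ 2 * pi *+ 2)); last first.
  by move: (@pi R) => q; ring.
rewrite sqrtrM ?sqr_ge0// sqrtr_sqr gtr0_norm// invfM mulrA divff ?gt_eqF// mul1r //.
Qed.

(* The tilts [c = 1/2] and [c = 2] of [normal_pdf_expR] give
   [E exp (-3 X^2 / (2 s^2)) = 1/2], hence [s^2 <= 3 E X^2] by [1 - y <= exp (-y)],
   and [E exp (3 X^2 / (8 s^2)) = 2]. *)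
Lemma gaussian_expR_sqr d (T : measurableType d) (R : realType)
    (P : probability T R) (X : T -> R) (V : R) : 0 < V ->
  centered_gaussian P X -> (\int[P]_w (X w ^+ 2)%:E <= V%:E)%E ->
  (\int[P]_w (expR (X w ^+ 2 / (8 * V)))%:E <= 2%:E)%E.
Proof.
move=> V0 [mX [[s [s0 PX]]|X0]] EX.
  have mgs c : measurable_fun setT (fun x : R => expR (x ^+ 2 / (2 * s ^+ 2) * (1 - c ^- 2))).
    apply: measurableT_comp => //; apply: measurable_funM => //.
    by apply: measurable_funM => //; exact: measurable_funX.
  have key c : 0 < c ->
      (\int[P]_w (expR (X w ^+ 2 / (2 * s ^+ 2) * (1 - c ^- 2)))%:E = c%:E)%E.
    move=> c0.
    rewrite (@ge0_integral_density _ _ _ P X (normal_pdf 0 s)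
      (fun x => (expR (x ^+ 2 / (2 * s ^+ 2) * (1 - c ^- 2)))%:E))//=.
    - under eq_integral do rewrite -EFinM normal_pdf_expR// EFinM.
      rewrite ge0_integralZl//= ?lee_fin ?(ltW c0)//.
      + by rewrite integral_normal_pdf mule1.
      + by apply/measurable_EFinP; exact: measurable_normal_pdf.
      + by move=> x _; rewrite lee_fin normal_pdf_ge0.
    - exact: measurable_normal_pdf.
    - by move=> x; exact: normal_pdf_ge0.
    - exact/measurable_EFinP.
  have sV : s ^+ 2 <= 3 * V.
    have : (1%:E <= (2^-1)%:E + (3 / (2 * s ^+ 2))%:E * V%:E :> \bar R)%E.
      apply: (@le_trans _ _
        ((2^-1)%:E + (3 / (2 * s ^+ 2))%:E * \int[P]_w (X w ^+ 2)%:E))%E; last first.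
        rewrite leeD2l// lee_wpmul2l// lee_fin.
        by rewrite divr_ge0// mulr_ge0// sqr_ge0.
      rewrite -(key 2^-1)// -ge0_integralZl//=; last 3 first.
        by apply/measurable_EFinP/measurable_funX.
        by move=> w _; rewrite lee_fin sqr_ge0.
        by rewrite lee_fin divr_ge0// mulr_ge0// sqr_ge0.
      rewrite -ge0_integralD//=; last 3 first.
        by apply/measurable_EFinP; exact: (measurableT_comp (mgs _)).
        by move=> w _; rewrite -EFinM lee_fin mulr_ge0 ?sqr_ge0// divr_ge0// mulr_ge0// sqr_ge0.
        by apply/measurable_EFinP/measurable_funM => //; exact/measurable_funX.
      have -> : 1%:E = (\int[P]_w 1%:E)%E.
        by rewrite integral_cst//= probability_setT mule1.
      apply: ge0_le_integral => //=.
        apply/(@measurable_EFinP _ _ _ _ (fun x : T =>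
          expR (X x ^+ 2 / (2 * s ^+ 2) * (1 - 2^-1 ^- 2)) + 3 / (2 * s ^+ 2) * X x ^+ 2)).
        apply: measurable_funD; first exact: (measurableT_comp (mgs _)).
        by apply: measurable_funM => //; exact: measurable_funX.
      move=> w _; rewrite -EFinM -EFinD lee_fin.
      have := expR_ge1Dx (X w ^+ 2 / (2 * s ^+ 2) * (1 - 2^-1 ^- 2)).
      lra.
    rewrite -EFinM -EFinD lee_fin => h.
    have : 2^-1 <= 3 * V / (2 * s ^+ 2) by lra.
    by rewrite ler_pdivlMr ?mulr_gt0 ?exprn_gt0//; lra.
  (* From [s^2 <= 3 V], the exponent [X^2 / (8 V)] is at most the exponent [3 X^2 / (8 s^2)] of the
     tilt [c = 2], whose expectation is exactly 2. *)
  rewrite -(key 2)//; apply: ge0_le_integral => //=.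
  - apply/measurable_EFinP/measurableT_comp => //; apply: measurable_funM => //.
    exact: measurable_funX.
  - by apply/measurable_EFinP; exact: (measurableT_comp (mgs _)).
  move=> w _; rewrite lee_fin ler_expR -mulrA ler_wpM2l ?sqr_ge0//.
  have -> : (2 * s ^+ 2)^-1 * (1 - 2 ^- 2) = (8 / 3 * s ^+ 2)^-1 by field; lra.
  rewrite lef_pV2 ?posrE ?mulr_gt0 ?exprn_gt0//; lra.
(* Degenerate case: [X] vanishes almost everywhere, so the integrand is almost everywhere 1. *)
rewrite (ae_eq_integral (cst 1%:E))//=.
- by rewrite integral_cst//= probability_setT mule1 lee_fin; lra.
- apply/measurable_EFinP/measurableT_comp => //; apply: measurable_funM => //.
  exact: measurable_funX.
- by apply: filterS X0 => w /= -> _; rewrite expr0n mul0r expR0.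
Qed.

(** * The integral of [min ((m u)^2) 1 / |u|^(2a+1)] *)

Lemma continuous_powR_gt0 (R : realType) (q x : R) : 0 < x ->
  {for x, continuous (fun u : R => u `^ q)}.
Proof.
move=> x0; apply: differentiable_continuous; apply/derivable1_diffP.
by apply: derivable_powR; rewrite in_itv/= andbT.
Qed.

Lemma integral_powR (R : realType) (q x y : R) : q != 0 -> 0 < x -> x < y ->
  (\int[lebesgue_measure]_(u in `[x, y]) (u `^ (q - 1))%:E =
   ((y `^ q - x `^ q) / q)%:E)%E.
Proof.
move=> q0 x0 xy.
have dF (z : R) : 0 < z -> is_derive z 1 (fun u : R => q^-1 * u `^ q) (z `^ (q - 1)).
  move=> z0; have h := is_derive1_powR q z0.
  have := is_derive_eq (is_deriveZ q^-1 h); apply.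
  by rewrite scalerA mulVf// scale1r.
have cF (z : R) : 0 < z -> {for z, continuous (fun u : R => q^-1 * u `^ q)}.
  by move=> z0; apply: cvgM; [exact: cvg_cst|exact: continuous_powR_gt0].
rewrite (@continuous_FTC2 _ _ (fun u => q^-1 * u `^ q))//.
- by rewrite -EFinB -mulrBr mulrC.
- apply/continuous_in_subspaceT => u; rewrite inE/= in_itv/= => /andP[xu _].
  by apply: continuous_powR_gt0; exact: lt_le_trans xu.
- split.
  + by move=> u; rewrite in_itv/= => /andP[xu _]; apply: ex_derive; apply: dF; exact: lt_trans xu.
  + by apply: cvg_at_right_filter; exact: cF.
  + by apply: cvg_at_left_filter; apply: cF; exact: lt_trans xy.
- move=> u; rewrite in_itv/= => /andP[xu _]; rewrite derive1E.
  by have /dF[_ ->] := lt_trans x0 xu.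
Qed.

Lemma ge0_integral_powR_le (R : realType) (f : R -> R) (k q x y : R) :
  q != 0 -> 0 <= k -> 0 < x -> x < y -> measurable_fun setT f ->
  (forall u, x <= u -> u <= y -> 0 <= f u <= k * u `^ (q - 1)) ->
  (\int[lebesgue_measure]_(u in `[x, y]) (f u)%:E <= (k * ((y `^ q - x `^ q) / q))%:E)%E.
Proof.
move=> q0 k0 x0 xy mf fk; rewrite EFinM -integral_powR//.
have mp : measurable_fun setT (fun u : R => u `^ (q - 1)) by exact: measurable_powR.
rewrite -ge0_integralZl//=; last 2 first.
- by apply/measurable_EFinP; exact: measurable_funTS.
- by move=> u _; rewrite lee_fin powR_ge0.
apply: ge0_le_integral => //=.
- by move=> u; rewrite in_itv/= => /andP[xu uy]; rewrite lee_fin; have /andP[] := fk _ xu uy.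
- by apply/measurable_EFinP; exact: measurable_funTS.
- apply/(@measurable_EFinP _ _ _ _ (fun u : R => k * u `^ (q - 1))).
  by apply: measurable_funM => //; exact: measurable_funTS.
- by move=> u; rewrite in_itv/= => /andP[xu uy]; rewrite -EFinM lee_fin; have /andP[] := fk _ xu uy.
Qed.

(** Exhaustion of the open half-line by compact intervals. The offset in [n.+2] keeps [c] strictly
    inside each of them, so that they can be cut at [c] into two nondegenerate pieces. *)
Lemma ge0_integral_itv0y_le (R : realType) (f : R -> R) (c B : R) : 0 < c ->
  measurable_fun setT f -> (forall u, 0 <= f u) ->
  (forall n : nat,
    (\int[lebesgue_measure]_(u in `[(c / n.+2%:R)%R, (c * n.+2%:R)%R]) (f u)%:E
     <= B%:E)%E) ->
  (\int[lebesgue_measure]_(u in `]0%R, +oo[) (f u)%:E <= B%:E)%E.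
Proof.
move=> c0 mf f0 fB.
pose F (n : nat) : set R := `[c / n.+2%:R, c * n.+2%:R]%classic.
have FE : \bigcup_n F n = `]0%R, +oo[%classic.
  apply/seteqP; split => u /=.
    move=> [n _]; rewrite /F/= !in_itv/= andbT => /andP[+ _]; apply: lt_le_trans.
    by rewrite divr_gt0.
  rewrite in_itv/= andbT => u0.
  have [n un] : exists n : nat, u / c < n%:R /\ c / u < n%:R.
    exists (maxn (Num.truncn (u / c)).+1 (Num.truncn (c / u)).+1); split.
      by rewrite (lt_le_trans (truncnS_gt _))// ler_nat leq_maxl.
    by rewrite (lt_le_trans (truncnS_gt _))// ler_nat leq_maxr.
  exists n => //; rewrite /F/= in_itv/= ler_pdivrMr// -ler_pdivrMl//.
  have nn : (n%:R : R) <= n.+2%:R by rewrite ler_nat (leq_trans (leqnSn _)).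
  rewrite mulrC (le_trans (ltW un.2))//= mulrC -ler_pdivrMr//.
  by rewrite (le_trans (ltW un.1)).
have ndF : nondecreasing_seq F.
  move=> i j ij; rewrite subsetEset /F => u /=; rewrite !in_itv/= => /andP[iu ui].
  have ij2 : (i.+2%:R : R) <= j.+2%:R by rewrite ler_nat !ltnS.
  apply/andP; split.
    by apply: le_trans iu; rewrite ler_pM2l// lef_pV2// posrE.
  by apply: (le_trans ui); rewrite ler_pM2l.
have mfF i : measurable_fun (F i) (EFin \o f).
  by apply/measurable_EFinP; exact: measurable_funTS.
have := @ge0_nondecreasing_set_cvg_integral _ (measurableTypeR R) R F (EFin \o f) lebesgue_measure
  ndF (fun i => measurable_itv _) mfF (fun i x _ => f0 x).
rewrite FE => cv; rewrite -(cvg_lim _ cv)//; apply: lime_le.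
  exact: cvgP cv.
by near=> n; exact: fB.
Unshelve. all: by end_near. Qed.

Lemma ge0_even_integral_le (R : realType) (f : R -> R) (B : R) :
  measurable_fun setT f -> (forall u, 0 <= f u) -> (forall u, f (- u) = f u) ->
  (\int[lebesgue_measure]_(u in `]0%R, +oo[) (f u)%:E <= B%:E)%E ->
  (\int[lebesgue_measure]_u (f u)%:E <= (2 * B)%:E)%E.
Proof.
move=> mf f0 fN fB.
have mfE : measurable_fun setT (EFin \o f) by exact/measurable_EFinP.
have -> : [set: R] = (`]-oo, 0%R] `|` `]0%R, +oo[)%classic.
  by rewrite -setCitvl setUv.
rewrite ge0_integral_setU//=; last 3 first.
- exact: measurable_funS mfE.
- by move=> x _; rewrite lee_fin.
- apply/eqP/seteqP; split => // x [] /=; rewrite !in_itv/= andbT => x0 /(le_lt_trans x0).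
  by rewrite ltxx.
have -> : (\int[lebesgue_measure]_(u in `]-oo, 0%R]) (f u)%:E =
           \int[lebesgue_measure]_(u in `]0%R, +oo[) (f u)%:E)%E.
  have := ge0_integration_by_substitution0 mfE (fun r => _ : (0 <= (EFin \o f) r)%E).
  move=> /(_ (fun r => f0 r)) h.
  rewrite -[RHS]/(\int[lebesgue_measure]_(u in `]0%R, +oo[) (EFin \o f) u)%E.
  rewrite integral_itv_obnd_cbnd ?h; last exact: measurable_funS mfE.
  by apply: eq_integral => u _ /=; rewrite fN.
by rewrite mulr2n mulrDl mul1r EFinD leeD.
Qed.

Lemma measurable_min_sqr_powR (R : realType) (m q : R) :
  measurable_fun setT (fun u : R => Num.min ((m * u) ^+ 2) 1 / `|u| `^ q).
Proof.
under eq_fun do rewrite -powRN; apply: measurable_funM.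
  apply: measurable_minr => //; apply: measurable_funX.
  exact: measurable_funM.
exact: (measurableT_comp (measurable_powR _)).
Qed.

(** The minimum changes regime at [|u| = 1/m]. Below, the integrand is at most [m^2 u^(1-2a)],
    integrable at 0 because [a < 1]; above, at most [u^(-2a-1)], integrable at infinity because
    [0 < a]. *)
Lemma integral_min_sqr_powR (R : realType) (a m : R) : 0 < a -> a < 1 -> 0 < m ->
  (\int[lebesgue_measure]_u (Num.min ((m * u) ^+ 2) 1 / `|u| `^ (2 * a + 1))%:E <=
   (((1 - a)^-1 + a^-1) * m `^ (2 * a))%:E)%E.
Proof.
move=> a0 a1 m0; pose f u := Num.min ((m * u) ^+ 2) 1 / `|u| `^ (2 * a + 1).
rewrite -[leLHS]/(\int[lebesgue_measure]_u (f u)%:E)%E.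
have mf : measurable_fun setT f by exact: measurable_min_sqr_powR.
have f0 u : 0 <= f u.
  by rewrite divr_ge0 ?powR_ge0// le_min sqr_ge0 ler01.
have m2a : m^-1 `^ (- (2 * a)) = m `^ (2 * a).
  by rewrite -(powR_inv1 (ltW m0)) -powRrM mulrNN mul1r.
have m22a : m ^+ 2 * m^-1 `^ (2 - 2 * a) = m `^ (2 * a).
  rewrite powRD; last by rewrite invr_eq0 (gt_eqF m0) implybT.
  rewrite m2a mulrA (powR_mulrn 2) ?invr_ge0 ?ltW// exprVn divff ?mul1r//.
  by rewrite expf_neq0// gt_eqF.
(* The outer 2 comes from evenness; the two terms bound the integrals below and above [1/m] on the
   positive half-line. *)
have -> : ((1 - a)^-1 + a^-1) * m `^ (2 * a) =
  2 * (m `^ (2 * a) / (2 - 2 * a) + m `^ (2 * a) / (2 * a)) by field; lra.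
apply: ge0_even_integral_le => //.
  by move=> u; rewrite /f mulrN sqrrN normrN.
apply: (@ge0_integral_itv0y_le _ _ m^-1) => //; first by rewrite invr_gt0.
move=> n; have c0 : 0 < m^-1 by rewrite invr_gt0.
have n1 : (1 : R) < n.+2%:R by rewrite ltr1n.
have xc : m^-1 / n.+2%:R < m^-1 by rewrite ltr_pdivrMr// ltr_pMr.
have cy : m^-1 < m^-1 * n.+2%:R by rewrite ltr_pMr.
have mfE : measurable_fun setT (EFin \o f) by exact/measurable_EFinP.
rewrite (@itv_bndbnd_setU _ _ _ (BRight m^-1)) ?bnd_simp//; last 2 first.
- exact: ltW.
- exact: ltW.
rewrite ge0_integral_setU//=; last 3 first.
- exact: measurable_funS mfE.
- by move=> x _; rewrite lee_fin.
- apply/eqP/seteqP; split => // x [] /=; rewrite !in_itv/=.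
  by move=> /andP[_ /le_lt_trans h] /andP[/h]; rewrite ltxx.
rewrite EFinD leeD//.
  apply: le_trans (@ge0_integral_powR_le _ f (m ^+ 2) (2 - 2 * a) _ _ _ _ _ xc mf _) _.
  - by apply/eqP; lra.
  - exact: sqr_ge0.
  - by rewrite divr_gt0.
  - move=> u xu uc; rewrite f0/= /f.
    have u0 : 0 < u by apply: lt_le_trans xu; rewrite divr_gt0.
    apply: (@le_trans _ _ ((m * u) ^+ 2 / `|u| `^ (2 * a + 1))).
      by rewrite ler_wpM2r ?invr_ge0 ?powR_ge0// ge_min lexx.
    rewrite gtr0_norm// exprMn -mulrA -powRN -(powR_mulrn 2 (ltW u0)) -powRD; last first.
      by rewrite (gt_eqF u0) implybT.
    by rewrite (_ : 2 - (2 * a + 1) = 2 - 2 * a - 1)//; ring.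
  - rewrite lee_fin mulrA mulrBr m22a; apply: ler_wpM2r; first by rewrite invr_ge0; lra.
    by rewrite gerBl mulr_ge0 ?sqr_ge0 ?powR_ge0.
apply: (@le_trans _ _ (\int[lebesgue_measure]_(u in `[m^-1%R, (m^-1 * n.+2%:R)%R]) (f u)%:E))%E.
  apply: ge0_subset_integral => //=; first exact: measurable_funS mfE.
    by move=> u _; rewrite lee_fin.
  by apply: subset_itvr; rewrite bnd_simp.
apply: le_trans (@ge0_integral_powR_le _ f 1 (- (2 * a)) _ _ _ _ _ cy mf _) _ => //.
- by apply/eqP; lra.
- move=> u cu uy; rewrite f0/= /f mul1r.
  have u0 : 0 < u by exact: lt_le_trans cu.
  apply: (@le_trans _ _ (1 / `|u| `^ (2 * a + 1))).
    by rewrite ler_wpM2r ?invr_ge0 ?powR_ge0// ge_min lexx orbT.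
  rewrite mul1r gtr0_norm// -powRN.
  by rewrite (_ : - (2 * a + 1) = - (2 * a) - 1)//; ring.
- rewrite lee_fin mul1r m2a invrN mulrN -mulNr opprB.
  apply: ler_wpM2r; first by rewrite invr_ge0; lra.
  by rewrite gerBl powR_ge0.
Qed.

(** * The covariance kernel *)

(** Both sides are [|e^(ix) - 1|^2]. *)
Lemma cosB1_sqrD_sin_sqr (R : realType) (x : R) :
  (cos x - 1) ^+ 2 + sin x ^+ 2 = 2 * (1 - cos x).
Proof. by have := cos2Dsin2 x; lra. Qed.

Lemma sin_sqr_le (R : realType) (x : R) : sin x ^+ 2 <= x ^+ 2.
Proof.
wlog x0 : x / 0 <= x.
  move=> h; have [/h//|/ltW x0] := leP 0 x.
  by have := h (- x); rewrite sinN !sqrrN oppr_ge0; apply.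
have [c _] := MVT_segment x0 (fun y _ => is_derive_sin y)
  (continuous_subspaceT (@continuous_sin R)).
by rewrite sin0 !subr0 => ->; rewrite exprMn ler_piMl ?sqr_ge0//.
Qed.

(** The bound by 4 is [cos x >= -1]; the quadratic one follows from the half-angle formula
    [1 - cos x = 2 sin^2 (x/2)]. *)
Lemma cosB1_sqrD_sin_sqr_le (R : realType) (x : R) :
  (cos x - 1) ^+ 2 + sin x ^+ 2 <= 4 * Num.min (x ^+ 2) 1.
Proof.
rewrite cosB1_sqrD_sin_sqr minr_pMr// le_min; apply/andP; split; last first.
  by have := cos_geN1 x; lra.
suff: 1 - cos x <= x ^+ 2 / 2 by have := sqr_ge0 x; lra.
have [y ->] : exists y, x = y *+ 2 by exists (x / 2); rewrite -[RHS]mulr_natr divfK.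
rewrite cos_mulr2n cos2sin2; have := sin_sqr_le _ y; lra.
Qed.

(** For [x <= y], [e^y - e^x <= (y - x) e^y] by [1 + z <= e^z] at [z = x - y]. Adding both
    exponentials on the right makes the bound symmetric in [x] and [y]. *)
Lemma expRB_le (R : realType) (x y : R) :
  (expR x - expR y) ^+ 2 <= 2 * (x - y) ^+ 2 * (expR (2 * x) + expR (2 * y)).
Proof.
wlog xy : x y / x <= y.
  move=> h; have [/h//|/ltW/h] := leP x y.
  by rewrite -[_ ^+ 2]sqrrN opprB -(sqrrN (y - x)) opprB [expR (2 * y) + _]addrC.
have e0 : 0 <= expR y - expR x by rewrite subr_ge0 ler_expR.
have : expR y - expR x <= (y - x) * expR y.
  have := expR_ge1Dx (x - y); rewrite expRB ler_pdivlMr ?expR_gt0//; lra.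
move=> h; have h2 : (expR y - expR x) ^+ 2 <= ((y - x) * expR y) ^+ 2.
  by apply: lerXn2r => //; rewrite nnegrE (le_trans e0).
rewrite -(sqrrN (expR x - expR y)) opprB (le_trans h2)//.
rewrite exprMn -(sqrrN (y - x)) opprB (_ : expR y ^+ 2 = expR (2 * y)); last first.
  by rewrite expRM_natl.
have := expR_ge0 (2 * x); have := expR_ge0 (2 * y); have := sqr_ge0 (x - y).
nra.
Qed.

(** Here [L] stands for [ln u]. The logarithm is absorbed by a loss [e] in the exponent, through
    [(e L)^2 <= exp (2 e |L|)]; the sign of [L] decides which of the two exponentials dominates. *)
Lemma sqr_expR_le (R : realType) (h1 h2 p e L : R) : h1 <= p <= h2 -> 0 < e ->
  L ^+ 2 * expR (2 * (- p * L)) <=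
  e ^- 2 * (expR (- (2 * (h1 - e)) * L) + expR (- (2 * (h2 + e)) * L)).
Proof.
move=> /andP[h1p ph2] e0.
have : (e * L) ^+ 2 <= expR (2 * (e * `|L|)).
  rewrite expRM_natl -real_normK ?num_real// normrM (gtr0_norm e0).
  rewrite lerXn2r ?nnegrE ?expR_ge0// ?mulr_ge0// ?ltW//.
  by have := expR_ge1Dx (e * `|L|); lra.
move=> h; have : L ^+ 2 <= e ^- 2 * expR (2 * (e * `|L|)).
  by rewrite ler_pdivlMl ?exprn_gt0// -exprMn.
move=> {}h; apply: (le_trans (ler_wpM2r (expR_ge0 _) h)).
rewrite -mulrA ler_wpM2l ?invr_ge0 ?sqr_ge0// -expRD.
have [L0|L0] := leP 0 L.
  apply: (@le_trans _ _ (expR (- (2 * (h1 - e)) * L))); last by rewrite lerDl expR_ge0.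
  by rewrite ler_expR (ger0_norm L0); nra.
apply: (@le_trans _ _ (expR (- (2 * (h2 + e)) * L))); last by rewrite lerDr expR_ge0.
by rewrite ler_expR (ltr0_norm L0); nra.
Qed.

(** Sensitivity of a power to its exponent: [expRB_le] at [- p ln u] and [- q ln u] produces the
    factor [(ln u)^2], which [sqr_expR_le] removes. *)
Lemma powRNB_sqr_le (R : realType) (h1 h2 p q e u : R) :
  h1 <= p <= h2 -> h1 <= q <= h2 -> 0 < e -> 0 < u ->
  (u `^ (- p) - u `^ (- q)) ^+ 2 <=
  4 * (p - q) ^+ 2 / e ^+ 2 * (u `^ (- (2 * (h1 - e))) + u `^ (- (2 * (h2 + e)))).
Proof.
move=> hp hq e0 u0; rewrite /powR (gt_eqF u0) /=.
apply: (le_trans (expRB_le _ _ _)).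
rewrite (_ : (- p * ln u - - q * ln u) ^+ 2 = (p - q) ^+ 2 * ln u ^+ 2); last by ring.
have := ler_wpM2l (sqr_ge0 (p - q)) (sqr_expR_le _ _ _ _ _ (ln u) hp e0).
have := ler_wpM2l (sqr_ge0 (p - q)) (sqr_expR_le _ _ _ _ _ (ln u) hq e0).
lra.
Qed.

(** The power of [|u|] is shared between the two times, which displays the kernel as the real inner
    product of [(e^(itu) - 1) |u|^(-H_t-1/2)] and its analogue at [s]. *)
Lemma mbm_kernelE (R : realType) (H : R -> R) (t s u : R) : u != 0 ->
  mbm_kernel H t s u =
  (cos (t * u) - 1) * `|u| `^ (- (H t + 2^-1)) * ((cos (s * u) - 1) * `|u| `^ (- (H s + 2^-1))) +
  sin (t * u) * `|u| `^ (- (H t + 2^-1)) * (sin (s * u) * `|u| `^ (- (H s + 2^-1))).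
Proof.
move=> u0; rewrite /mbm_kernel -powRN.
have -> : - (H t + H s + 1) = - (H t + 2^-1) + - (H s + 2^-1) by field.
by rewrite powRD ?normr_eq0 ?u0 ?implybT//; ring.
Qed.

Lemma mbm_kernel0 (R : realType) (H : R -> R) (t s : R) : mbm_kernel H t s 0 = 0.
Proof. by rewrite /mbm_kernel !mulr0 cos0 sin0 subrr !mul0r addr0 mul0r. Qed.

Lemma measurable_mbm_kernel (R : realType) (H : R -> R) (t s : R) :
  measurable_fun setT (mbm_kernel H t s).
Proof.
have mc (r : R) : measurable_fun setT (fun u : R => cos (r * u)).
  apply: (measurableT_comp (continuous_measurable_fun (@continuous_cos R))).
  exact: measurable_funM.
have ms (r : R) : measurable_fun setT (fun u : R => sin (r * u)).
  apply: (measurableT_comp (continuous_measurable_fun (@continuous_sin R))).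
  exact: measurable_funM.
rewrite /mbm_kernel; under eq_fun do rewrite -powRN.
apply: measurable_funM; last exact: (measurableT_comp (measurable_powR _)).
by apply: measurable_funD; apply: measurable_funM => //; exact: measurable_funB.
Qed.

Lemma mbm_kernel_diag_ge0 (R : realType) (H : R -> R) (t u : R) : 0 <= mbm_kernel H t t u.
Proof. by rewrite divr_ge0 ?powR_ge0// addr_ge0// -expr2 sqr_ge0. Qed.

Lemma mbm_kernel_diag_le (R : realType) (H : R -> R) (t u : R) :
  mbm_kernel H t t u <= 4 * (Num.min ((t * u) ^+ 2) 1 / `|u| `^ (2 * H t + 1)).
Proof.
rewrite /mbm_kernel (_ : H t + H t + 1 = 2 * H t + 1); last by ring.
rewrite mulrA ler_wpM2r ?invr_ge0 ?powR_ge0// -!expr2.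
exact: cosB1_sqrD_sin_sqr_le.
Qed.

(** The combination is the squared modulus of the difference of the Fourier kernels at [t] and
    [s]. *)
Lemma mbm_kernel_incr_ge0 (R : realType) (H : R -> R) (t s u : R) :
  0 <= mbm_kernel H t t u - 2 * mbm_kernel H t s u + mbm_kernel H s s u.
Proof.
have [->|u0] := eqVneq u 0; first by rewrite !mbm_kernel0; lra.
rewrite !mbm_kernelE//.
set x := _ `^ _; set y := _ `^ _.
have := sqr_ge0 ((cos (t * u) - 1) * x - (cos (s * u) - 1) * y).
have := sqr_ge0 (sin (t * u) * x - sin (s * u) * y).
lra.
Qed.

Lemma mbm_kernel_abs_le (R : realType) (H : R -> R) (t s u : R) :
  `|mbm_kernel H t s u| <= mbm_kernel H t t u + mbm_kernel H s s u.
Proof.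
have [->|u0] := eqVneq u 0; first by rewrite !mbm_kernel0 normr0 addr0.
rewrite !mbm_kernelE//.
set x := _ `^ _; set y := _ `^ _; set A := cos (t * u) - 1; set B := cos (s * u) - 1.
have := sqr_ge0 (A * x - B * y); have := sqr_ge0 (A * x + B * y).
have := sqr_ge0 (sin (t * u) * x - sin (s * u) * y).
have := sqr_ge0 (sin (t * u) * x + sin (s * u) * y).
rewrite ler_norml; move=> *; apply/andP; split; lra.
Qed.

(** The first term on the right comes from changing the time at fixed exponent [H t], the second
    from changing the exponent at fixed time [s]. The latter carries the factor [e^(isu) - 1], which
    vanishes at [s = 0]; hence [k] has to bound the increment of [H] for positive [s] only. *)
Lemma mbm_kernel_incr_le (R : realType) (H : R -> R) (t s u h1 h2 e k m : R) :
  h1 <= H t <= h2 -> h1 <= H s <= h2 -> 0 < e -> 0 <= s -> s <= m ->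
  (0 < s -> `|H t - H s| <= k) ->
  mbm_kernel H t t u - 2 * mbm_kernel H t s u + mbm_kernel H s s u <=
  8 * (Num.min (((t - s) * u) ^+ 2) 1 / `|u| `^ (2 * H t + 1)) +
  32 * k ^+ 2 / e ^+ 2 *
    (Num.min ((m * u) ^+ 2) 1 / `|u| `^ (2 * (h1 - e) + 1) +
     Num.min ((m * u) ^+ 2) 1 / `|u| `^ (2 * (h2 + e) + 1)).
Proof.
move=> hHt hHs e0 s0 sm hk.
have min0 (x : R) : 0 <= Num.min (x ^+ 2) 1 by rewrite le_min sqr_ge0 ler01.
have [->|u0] := eqVneq u 0.
  have MN (x q : R) : 0 <= Num.min (x ^+ 2) 1 / `|0 : R| `^ q by rewrite divr_ge0 ?powR_ge0.
  rewrite !mbm_kernel0 mulr0 subr0 addr0.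
  by apply: addr_ge0; apply: mulr_ge0; rewrite ?addr_ge0 ?divr_ge0 ?sqr_ge0// mulr_ge0 ?sqr_ge0.
have v0 : 0 < `|u| by rewrite normr_gt0.
rewrite !mbm_kernelE// -!powRN; set v := `|u| in v0 *.
set x := v `^ (- (H t + 2^-1)); set y := v `^ (- (H s + 2^-1)).
have x2 : v `^ (- (2 * H t + 1)) = x ^+ 2.
  by rewrite expr2 -powRD ?(gt_eqF v0) ?implybT//; congr (_ `^ _); field.
have vD (q : R) : v `^ (- (2 * q + 1)) = v `^ (- (2 * q)) * v^-1.
  by rewrite opprD powRD ?(gt_eqF v0) ?implybT// powR_inv1 ?ltW.
(* The common exponent [-1/2] contributes [1/v] once squared, leaving powers with exponents in
   [[h1, h2]] up to sign. *)
have xy : (x - y) ^+ 2 = (v `^ (- H t) - v `^ (- H s)) ^+ 2 * v^-1.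
  rewrite /x /y !opprD !powRD ?(gt_eqF v0) ?implybT// -mulrBl exprMn; congr (_ * _).
  rewrite expr2 -powRD ?(gt_eqF v0) ?implybT// -opprD.
  by rewrite (_ : 2^-1 + 2^-1 = 1 :> R) ?powR_inv1 ?ltW//; field.
(* By rotation, [|e^(itu) - e^(isu)| = |e^(i(t-s)u) - 1|]. *)
have D1 : (cos (t * u) - cos (s * u)) ^+ 2 + (sin (t * u) - sin (s * u)) ^+ 2 <=
    4 * Num.min (((t - s) * u) ^+ 2) 1.
  apply: le_trans (cosB1_sqrD_sin_sqr_le _ _); rewrite cosB1_sqrD_sin_sqr mulrBl cosB.
  by have := cos2Dsin2 (t * u); have := cos2Dsin2 (s * u); lra.
have D2 : ((cos (s * u) - 1) ^+ 2 + sin (s * u) ^+ 2) * (x - y) ^+ 2 <=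
    16 * k ^+ 2 / e ^+ 2 * (Num.min ((m * u) ^+ 2) 1 *
      (v `^ (- (2 * (h1 - e) + 1)) + v `^ (- (2 * (h2 + e) + 1)))).
  have S0 : 0 <= v `^ (- (2 * (h1 - e))) + v `^ (- (2 * (h2 + e))) by rewrite addr_ge0 ?powR_ge0.
  move: s0; rewrite le_eqVlt => /predU1P[<-|s0].
    rewrite mul0r cos0 sin0 subrr expr0n/= addr0 mul0r.
    apply: mulr_ge0; first by rewrite divr_ge0 ?sqr_ge0// mulr_ge0 ?sqr_ge0.
    by rewrite mulr_ge0 ?addr_ge0 ?powR_ge0.
  have E1 : (cos (s * u) - 1) ^+ 2 + sin (s * u) ^+ 2 <= 4 * Num.min ((m * u) ^+ 2) 1.
    apply: (le_trans (cosB1_sqrD_sin_sqr_le _ _)); rewrite ler_wpM2l//.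
    rewrite le_min !ge_min lexx orbT andbT; apply/orP; left.
    by rewrite !exprMn ler_wpM2r ?sqr_ge0// lerXn2r// nnegrE ltW// (lt_le_trans s0).
  have E2 : (x - y) ^+ 2 <= 4 * k ^+ 2 / e ^+ 2 *
      (v `^ (- (2 * (h1 - e) + 1)) + v `^ (- (2 * (h2 + e) + 1))).
    rewrite xy !vD -mulrDl mulrA ler_wpM2r ?invr_ge0 ?(ltW v0)//.
    apply: (le_trans (powRNB_sqr_le _ _ _ _ _ _ _ hHt hHs e0 v0)).
    rewrite ler_wpM2r// ler_wpM2r ?invr_ge0 ?sqr_ge0// ler_wpM2l//.
    by rewrite -real_normK ?num_real// lerXn2r ?nnegrE ?hk// (le_trans _ (hk s0)).
  apply: (le_trans (ler_pM _ _ E1 E2)); rewrite ?addr_ge0 ?sqr_ge0//.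
  by lra.
(* [A x - B y = (A - B) x + B (x - y)], and [(a + b)^2 <= 2 a^2 + 2 b^2]. *)
move: D1 D2; rewrite x2 -mulrDr; set M1 := Num.min _ _; set M2 := Num.min _ _ => D1 D2.
have D1x := ler_wpM2r (sqr_ge0 x) D1.
have := sqr_ge0 ((cos (t * u) - cos (s * u)) * x - (cos (s * u) - 1) * (x - y)).
have := sqr_ge0 ((sin (t * u) - sin (s * u)) * x - sin (s * u) * (x - y)).
lra.
Qed.

(** The pointwise bound is integrated term by term; the conditions on [e] keep [h1 - e] and [h2 + e]
    in []0, 1[], where [integral_min_sqr_powR] applies. *)
Lemma integral_mbm_kernel_incr_le (R : realType) (H : R -> R) (t s h1 h2 e k m : R) :
  0 < e -> e < h1 -> h2 + e < 1 ->
  h1 <= H t <= h2 -> h1 <= H s <= h2 -> 0 <= s -> s < t -> s <= m -> 0 < m ->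
  (0 < s -> `|H t - H s| <= k) ->
  (\int[lebesgue_measure]_u
     (mbm_kernel H t t u - 2 * mbm_kernel H t s u + mbm_kernel H s s u)%:E <=
   (8 * (((1 - H t)^-1 + (H t)^-1) * (t - s) `^ (2 * H t)) +
    32 * k ^+ 2 / e ^+ 2 *
      (((1 - (h1 - e))^-1 + (h1 - e)^-1) * m `^ (2 * (h1 - e)) +
       ((1 - (h2 + e))^-1 + (h2 + e)^-1) * m `^ (2 * (h2 + e))))%:E)%E.
Proof.
move=> e0 eh1 h2e hHt hHs s0 st sm m0 hk.
have /andP[h1t th2] := hHt.
pose M (n q u : R) := Num.min ((n * u) ^+ 2) 1 / `|u| `^ q.
have mM n q : measurable_fun setT (fun u => (M n q u)%:E).
  by apply/measurable_EFinP; exact: measurable_min_sqr_powR.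
have M0 n q u : (0 <= (M n q u)%:E)%E.
  by rewrite lee_fin divr_ge0 ?powR_ge0// le_min sqr_ge0 ler01.
have c0 : 0 <= 32 * k ^+ 2 / e ^+ 2 by rewrite divr_ge0 ?sqr_ge0// mulr_ge0 ?sqr_ge0.
apply: (@le_trans _ _ (\int[lebesgue_measure]_u (8%:E * (M (t - s) (2 * H t + 1) u)%:E +
   (32 * k ^+ 2 / e ^+ 2)%:E * ((M m (2 * (h1 - e) + 1) u)%:E + (M m (2 * (h2 + e) + 1) u)%:E)))%E).
  apply: ge0_le_integral => //=.
  - by move=> u _; rewrite lee_fin mbm_kernel_incr_ge0.
  - apply/measurable_EFinP; apply: measurable_funD; last exact: measurable_mbm_kernel.
    apply: measurable_funB; first exact: measurable_mbm_kernel.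
    by apply: measurable_funM => //; exact: measurable_mbm_kernel.
  - apply/(@measurable_EFinP _ _ _ _ (fun u => 8 * M (t - s) (2 * H t + 1) u +
      32 * k ^+ 2 / e ^+ 2 * (M m (2 * (h1 - e) + 1) u + M m (2 * (h2 + e) + 1) u))).
    apply: measurable_funD; apply: measurable_funM => //.
      exact: measurable_min_sqr_powR.
    by apply: measurable_funD; exact: measurable_min_sqr_powR.
  - move=> u _; rewrite lee_fin; exact: mbm_kernel_incr_le.
rewrite ge0_integralD//=; last 4 first.
- by move=> u _; apply: mule_ge0; [rewrite lee_fin|exact: M0].
- by apply/(@measurable_EFinP _ _ _ _ (fun u => 8 * M (t - s) (2 * H t + 1) u));
    apply: measurable_funM => //; exact: measurable_min_sqr_powR.
- by move=> u _; apply: mule_ge0; [rewrite lee_fin|apply: adde_ge0; exact: M0].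
- apply/(@measurable_EFinP _ _ _ _ (fun u =>
      32 * k ^+ 2 / e ^+ 2 * (M m (2 * (h1 - e) + 1) u + M m (2 * (h2 + e) + 1) u))).
  by apply: measurable_funM => //; apply: measurable_funD; exact: measurable_min_sqr_powR.
rewrite ge0_integralZl//= ?lee_fin//; last exact: mM.
rewrite ge0_integralZl//= ?lee_fin//; last 2 first.
- apply/(@measurable_EFinP _ _ _ _ (fun u => M m (2 * (h1 - e) + 1) u + M m (2 * (h2 + e) + 1) u)).
  by apply: measurable_funD; exact: measurable_min_sqr_powR.
- by move=> u _; rewrite adde_ge0.
rewrite ge0_integralD//=; [|exact: mM..].
rewrite [in leRHS]EFinD [in leRHS](EFinM 8) [in leRHS](EFinM (32 * _ / _)).
apply: leeD; apply: lee_wpmul2l; rewrite ?lee_fin//.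
  by apply: integral_min_sqr_powR; lra.
by rewrite EFinD; apply: leeD; apply: integral_min_sqr_powR; lra.
Qed.

(** The diagonal kernels are controlled by [integral_min_sqr_powR], and they dominate the others by
    [mbm_kernel_abs_le]. *)
Lemma integrable_mbm_kernel (R : realType) (H : R -> R) (t s : R) :
  0 < H t < 1 -> 0 < H s < 1 ->
  (@lebesgue_measure R).-integrable setT (EFin \o mbm_kernel H t s).
Proof.
have diag r : 0 < H r < 1 ->
    (@lebesgue_measure R).-integrable setT (EFin \o mbm_kernel H r r).
  move=> /andP[Hr0 Hr1]; have mk : measurable_fun setT (EFin \o mbm_kernel H r r).
    by apply/measurable_EFinP; exact: measurable_mbm_kernel.
  apply/integrableP; split => //.
  (* The time [r] may be zero or negative, so it is replaced by the positive scale [|r| + 1]. *)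
  apply: (@le_lt_trans _ _ (\int[lebesgue_measure]_u (4%:E *
    (Num.min (((`|r| + 1) * u) ^+ 2) 1 / `|u| `^ (2 * H r + 1))%:E))%E).
    apply: ge0_le_integral => //=.
    - by apply/measurable_EFinP; apply: measurableT_comp => //; exact: measurable_mbm_kernel.
    - apply/(@measurable_EFinP _ _ _ _ (fun u => 4 *
        (Num.min (((`|r| + 1) * u) ^+ 2) 1 / `|u| `^ (2 * H r + 1)))).
      by apply: measurable_funM => //; exact: measurable_min_sqr_powR.
    - move=> u _; rewrite -EFinM lee_fin ger0_norm ?mbm_kernel_diag_ge0//.
      apply: (le_trans (mbm_kernel_diag_le _ _ _ _)).
      rewrite ler_wpM2l// ler_wpM2r ?invr_ge0 ?powR_ge0//.
      rewrite le_min !ge_min lexx orbT andbT; apply/orP; left.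
      rewrite -[leLHS]real_normK ?num_real// -[leRHS]real_normK ?num_real//.
      rewrite lerXn2r ?nnegrE// !normrM ler_wpM2r//.
      by rewrite [leRHS]ger0_norm ?addr_ge0// lerDl.
  rewrite ge0_integralZl//=; last 2 first.
  - by apply/measurable_EFinP; exact: measurable_min_sqr_powR.
  - by move=> u _; rewrite lee_fin divr_ge0 ?powR_ge0// le_min sqr_ge0 ler01.
  have r0 : 0 < `|r| + 1 by rewrite ltr_wpDl.
  apply: lte_mul_pinfty; rewrite ?lee_fin//.
  exact: (le_lt_trans (integral_min_sqr_powR _ _ _ Hr0 Hr1 r0) (ltry _)).
move=> hHt hHs.
have h := integrableD measurableT (diag _ hHt) (diag _ hHs).
apply: (le_integrable measurableT _ _ h).
- by apply/measurable_EFinP; exact: measurable_mbm_kernel.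
- move=> u _; rewrite lee_fin (le_trans (mbm_kernel_abs_le _ _ _ _ _))//.
  exact: ler_norm.
Qed.

(** * Variance of the increments *)

(** Used over the frequencies and over the probability space, to carry the covariance identity over
    to squared increments. *)
Lemma integral_sqrB_expand d (T : measurableType d) (R : realType)
    (mu : {measure set T -> \bar R}) (f g h : T -> R) :
  mu.-integrable setT (EFin \o f) -> mu.-integrable setT (EFin \o g) ->
  mu.-integrable setT (EFin \o h) ->
  (\int[mu]_w (f w - 2 * g w + h w)%:E =
   \int[mu]_w (f w)%:E - 2%:E * \int[mu]_w (g w)%:E + \int[mu]_w (h w)%:E)%E.
Proof.
move=> fi gi hi; have g2i := integrableZl measurableT 2 gi.
have fgi := integrableB measurableT fi g2i.
rewrite -(integralZl measurableT gi) -(integralB measurableT fi g2i).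
by rewrite -(integralD measurableT fgi hi).
Qed.

Lemma mbm_measurable d (T : measurableType d) (R : realType)
    (P : probability T R) (H : R -> R) (Y : R -> T -> R) (t : R) :
  is_harmonizable_mBm P H Y -> 0 <= t -> measurable_fun setT (Y t).
Proof.
move=> [G _] t0; have [+ _] := G 1%N (fun=> t) (fun=> 1) (fun=> t0).
by under eq_fun do rewrite big_ord1 mul1r.
Qed.

Lemma mbm_incr_gaussian d (T : measurableType d) (R : realType)
    (P : probability T R) (H : R -> R) (Y : R -> T -> R) (t s : R) :
  is_harmonizable_mBm P H Y -> 0 <= t -> 0 <= s ->
  centered_gaussian P (fun w => Y t w - Y s w).
Proof.
move=> [G _] t0 s0.
have := G 2%N (fun i => if i == ord0 then t else s) (fun i => if i == ord0 then 1 else -1).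
have -> : (fun w => \sum_(i < 2) (if i == ord0 then 1 else -1) * Y (if i == ord0 then t else s) w) =
    (fun w => Y t w - Y s w).
  by apply/funext => w; rewrite big_ord_recl big_ord1 /= mul1r mulN1r.
by apply => i; case: ifP.
Qed.

(** Polarization of the covariance identity. Square integrability of [Y] is itself read off that
    identity on the diagonal, where the kernel has a finite integral. *)
Lemma mbm_incr_sqr d (T : measurableType d) (R : realType)
    (P : probability T R) (H : R -> R) (Y : R -> T -> R) (t s : R) :
  is_harmonizable_mBm P H Y -> 0 <= t -> 0 <= s ->
  0 < H t < 1 -> 0 < H s < 1 ->
  (\int[P]_w ((Y t w - Y s w) ^+ 2)%:E =
   \int[lebesgue_measure]_u
     (mbm_kernel H t t u - 2 * mbm_kernel H t s u + mbm_kernel H s s u)%:E)%E.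
Proof.
move=> YP t0 s0 Ht Hs; have [_ [cov _]] := YP.
have covE a b : 0 <= a -> 0 <= b ->
    (\int[P]_w (Y a w * Y b w)%:E = \int[lebesgue_measure]_u (mbm_kernel H a b u)%:E)%E.
  by move=> a0 b0; rewrite -cov// unlock.
have mY a b : 0 <= a -> 0 <= b -> measurable_fun setT (fun w => Y a w * Y b w).
  by move=> a0 b0; apply: measurable_funM; exact: mbm_measurable YP _.
have diag a : 0 <= a -> 0 < H a < 1 -> P.-integrable setT (EFin \o (fun w => Y a w * Y a w)).
  move=> a0 Ha; apply/integrableP; split; first exact/measurable_EFinP/mY.
  under eq_integral do rewrite /= ger0_norm -?expr2 ?sqr_ge0// expr2.
  by rewrite covE//; exact: integrable_lty (integrable_mbm_kernel _ _ _ _ Ha Ha).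
have offdiag : P.-integrable setT (EFin \o (fun w => Y t w * Y s w)).
  have h := integrableD measurableT (diag _ t0 Ht) (diag _ s0 Hs).
  apply: (le_integrable measurableT _ _ h); first exact/measurable_EFinP/mY.
  move=> w _; rewrite lee_fin (le_trans _ (ler_norm _))//.
  have := sqr_ge0 (Y t w - Y s w); have := sqr_ge0 (Y t w + Y s w).
  by rewrite ler_norml => *; apply/andP; split; nra.
rewrite integral_sqrB_expand; [|exact: integrable_mbm_kernel..].
rewrite -!covE// -integral_sqrB_expand//; last 2 first.
- exact: diag.
- exact: diag.
by apply: eq_integral => w _; congr EFin; ring.
Qed.

(** As [t - s <= 1], both [(t-s)^(2 H_t)] and [(t-s)^(2 kappa)] are at most [(t-s)^(2 h3)]; as
    [max t 1 >= 1], its powers are at most the one of exponent [2 (h2 + e)]. *)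
Lemma mbm_incr_sqr_le d (T : measurableType d) (R : realType)
    (P : probability T R) (H : R -> R) (Y : R -> T -> R) (h1 h2 D kappa e : R) :
  is_harmonizable_mBm P H Y ->
  (forall t, 0 <= t -> h1 <= H t <= h2) -> 0 < kappa ->
  (forall t s, 0 < s -> s <= t -> `|H t - H s| <= D * (t - s) `^ kappa) ->
  0 < e -> e < h1 -> h2 + e < 1 ->
  exists2 C : R, 0 < C & forall s t : R, 0 <= s -> s < t -> t <= s + 1 ->
    (\int[P]_w ((Y t w - Y s w) ^+ 2)%:E <=
     (C * (Num.max t 1 `^ (h2 + e) * (t - s) `^ Num.min h1 kappa) ^+ 2)%:E)%E.
Proof.
move=> YP Hh kappa0 HD e0 eh1 h2e.
have [h10 h21] : 0 < h1 /\ h2 < 1 by lra.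
have h12 : h1 <= h2 by have /andP[/le_trans/[apply]] := Hh 0 (lexx _).
pose K a : R := (1 - a)^-1 + a^-1.
have K0 a : 0 < a -> a < 1 -> 0 < K a.
  by move=> a0 a1; rewrite addr_gt0 ?invr_gt0// subr_gt0.
(* [B] bounds [K (H t)] uniformly in [t], by (H1). *)
pose B := (1 - h2)^-1 + h1^-1.
have B0 : 0 < B by rewrite addr_gt0 ?invr_gt0// subr_gt0.
pose C := 8 * B + 32 * D ^+ 2 / e ^+ 2 * (K (h1 - e) + K (h2 + e)).
have K10 : 0 < K (h1 - e) by apply: K0; lra.
have K20 : 0 < K (h2 + e) by apply: K0; lra.
have c0 : 0 <= 32 * D ^+ 2 / e ^+ 2 by rewrite divr_ge0 ?sqr_ge0// mulr_ge0 ?sqr_ge0.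
exists C.
  by rewrite ltr_pwDl ?mulr_gt0// mulr_ge0// addr_ge0 ?ltW.
move=> s t s0 st ts; have t0 : 0 <= t by lra.
have H01 r : 0 <= r -> 0 < H r < 1.
  by move=> /Hh/andP[? ?]; apply/andP; split; lra.
rewrite (@mbm_incr_sqr _ _ _ _ H)//; [|exact: H01..].
set m := Num.max t 1; set h3 := Num.min h1 kappa.
have m1 : 1 <= m by rewrite le_max lexx orbT.
have h30 : 0 < h3 by rewrite lt_min h10.
have /andP[h1t th2] := Hh _ t0.
apply: (le_trans (@integral_mbm_kernel_incr_le _ H t s h1 h2 e (D * (t - s) `^ kappa) m
  _ _ _ _ _ _ _ _ _ _)) => //; [exact: Hh|exact: Hh| | | |].
- by rewrite (le_trans (ltW st))// le_max lexx.
- exact: lt_le_trans m1.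
- by move=> s_gt0; apply: HD => //; exact: ltW.
have d01 : 0 < t - s <= 1 by apply/andP; split; lra.
have dsq q : h3 <= q -> (t - s) `^ (2 * q) <= ((t - s) `^ h3) ^+ 2.
  move=> hq; rewrite -powR_mulrn ?powR_ge0// -powRrM mulrC.
  by apply: ger_powR => //; rewrite ler_pM2r.
have msq : m `^ (2 * (h2 + e)) = (m `^ (h2 + e)) ^+ 2.
  by rewrite -powR_mulrn ?powR_ge0// -powRrM mulrC.
have m2a : m `^ (2 * (h1 - e)) <= m `^ (2 * (h2 + e)) by apply: ler_powR => //; lra.
have m21 : 1 <= m `^ (2 * (h2 + e)).
  by rewrite -[leLHS](powRr0 m) ler_powR//; lra.
rewrite lee_fin [in leRHS]exprMn -msq.
set d3 := ((t - s) `^ h3) ^+ 2; set M := m `^ (2 * (h2 + e)) in m2a m21 *.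
have d30 : 0 <= d3 by rewrite sqr_ge0.
rewrite [in leRHS]/C [in leRHS]mulrDl; apply: lerD.
  rewrite -mulrA ler_wpM2l//; apply: ler_pM; rewrite ?powR_ge0//.
  - by rewrite ltW// K0//; lra.
  - by apply: lerD; rewrite lef_pV2 ?posrE//; lra.
  - have h3t : h3 <= H t by rewrite (le_trans _ h1t)// ge_min lexx.
    by rewrite (le_trans (dsq _ h3t))// ler_peMl.
have -> : 32 * (D * (t - s) `^ kappa) ^+ 2 / e ^+ 2 =
    32 * D ^+ 2 / e ^+ 2 * (t - s) `^ (2 * kappa).
  by rewrite [2 * kappa]mulrC powRrM powR_mulrn ?powR_ge0//; ring.
rewrite -[X in X <= _]mulrA.
have -> : 32 * D ^+ 2 / e ^+ 2 * (K (h1 - e) + K (h2 + e)) * (M * d3) =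
    32 * D ^+ 2 / e ^+ 2 * (d3 * ((K (h1 - e) + K (h2 + e)) * M)) by ring.
apply: ler_wpM2l => //; apply: ler_pM; rewrite ?powR_ge0//.
- by rewrite addr_ge0// mulr_ge0 ?powR_ge0// ltW.
- by apply: dsq; rewrite ge_min lexx orbT.
- by rewrite [in leRHS]mulrDl lerD2r; apply: ler_wpM2l => //; exact: ltW.
Qed.

(** * Dyadic chaining *)

(** Partial sums of the differentiated geometric series, in closed form by induction. *)
Lemma sum_succ_geometric_le (R : realType) (r : R) (k : nat) : 0 <= r -> r < 1 ->
  \sum_(i < k) (i.+1%:R * r ^+ i) <= (1 - r) ^- 2.
Proof.
move=> r0 r1; have d0 : 0 < (1 - r) ^+ 2 by rewrite exprn_gt0// subr_gt0.
have key : (1 - r) ^+ 2 * \sum_(i < k) (i.+1%:R * r ^+ i) =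
    1 - k.+1%:R * r ^+ k + k%:R * r ^+ k.+1.
  elim: k => [|k IH]; first by rewrite big_ord0 mulr0 expr0 mul0r addr0 mul1r subrr.
  rewrite big_ord_recr /= mulrDr IH -(natr1 k.+1) -(natr1 k) !exprS; ring.
rewrite -(ler_pM2l d0) key divff ?gt_eqF// -addrA gerDl addrC subr_le0 exprS mulrA.
apply: ler_wpM2r; first exact: exprn_ge0.
by rewrite (le_trans (ler_piMr _ (ltW r1)))// ler_nat.
Qed.

Definition dyadic_floor (R : realType) (n : nat) (t : R) : R :=
  (Num.truncn (2 ^+ n * t))%:R / 2 ^+ n.

Lemma dyadic_floor_itv (R : realType) (n : nat) (t : R) : 0 <= t ->
  0 <= dyadic_floor R n t <= t /\ t < dyadic_floor R n t + 2 ^- n.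
Proof.
move=> t0; have e0 : 0 < 2 ^+ n :> R by rewrite exprn_gt0.
have /andP[h1 h2] := truncn_itv (mulr_ge0 (ltW e0) t0).
rewrite /dyadic_floor divr_ge0 ?(ltW e0)//= ler_pdivrMr// [t * _]mulrC h1; split => //.
by rewrite -[X in _ + X]mul1r -mulrDl ltr_pdivlMr// mulrC natr1.
Qed.

Lemma nat_eq_or_succ (i j : nat) : (j < i.+1)%N -> (i < j.+2)%N -> i = j \/ i = j.+1.
Proof.
rewrite !ltnS leq_eqVlt => /predU1P[->|ji ij]; first by left.
by right; apply/eqP; rewrite eqn_leq ij.
Qed.

Section chaining.
Variables (R : realType) (f W : R -> R) (A r : R).
Hypotheses (cf : {within [set t : R | 0 <= t], continuous f}).
Hypotheses (A0 : 0 <= A) (r0 : 0 <= r) (r1 : r < 1).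
Hypothesis W0 : forall t, 0 <= W t.
Hypothesis W_nd : forall s t, 0 <= s -> s <= t -> W s <= W t.
Hypothesis incr : forall n j : nat,
  `|f (j.+1%:R / 2 ^+ n) - f (j%:R / 2 ^+ n)| <=
  A * W (j.+1%:R / 2 ^+ n) * (n.+1%:R * r ^+ n).

(** Monotonicity of [W] charges every dyadic increment ending before [t] to the single weight
    [W t]. *)
Lemma incr_le_weight (n j : nat) (t : R) : j.+1%:R / 2 ^+ n <= t ->
  `|f (j.+1%:R / 2 ^+ n) - f (j%:R / 2 ^+ n)| <= A * W t * (n.+1%:R * r ^+ n).
Proof.
move=> jt; apply: (le_trans (incr n j)).
by rewrite ler_wpM2r ?mulr_ge0 ?exprn_ge0// ler_wpM2l// W_nd.
Qed.

(** If the floor at scale [n] has index [j], the one at scale [n.+1] has index [j.*2] or [j.*2.+1]: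
    either nothing moves or one dyadic increment is crossed. *)
Lemma dyadic_floor_step (n : nat) (t : R) : 0 <= t ->
  `|f (dyadic_floor R n.+1 t) - f (dyadic_floor R n t)| <=
  A * W t * (n.+2%:R * r ^+ n.+1).
Proof.
move=> t0; have e0 : 0 < 2 ^+ n :> R by rewrite exprn_gt0.
have /andP[h1 h2] := truncn_itv (mulr_ge0 (ltW e0) t0).
have e1 : 0 < 2 ^+ n.+1 :> R by rewrite exprn_gt0.
have /andP[h3 h4] := truncn_itv (mulr_ge0 (ltW e1) t0).
have [/andP[/= + _] _] := dyadic_floor_itv _ n.+1 _ t0.
have [/andP[/= _ +] _] := dyadic_floor_itv _ n.+1 _ t0.
rewrite /dyadic_floor; move: h1 h2 h3 h4.
set j := Num.truncn _; set i := Num.truncn _ => h1 h2 h3 h4 it _.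
have -> : j%:R / 2 ^+ n = (j.*2)%:R / 2 ^+ n.+1 :> R.
  by rewrite -muln2 natrM exprSr -mulf_div divff ?mulr1.
have [|] : i = j.*2 \/ i = j.*2.+1.
  have : (j.*2 < i.+1)%N.
    rewrite -(ltr_nat R) -muln2 natrM (le_lt_trans _ h4)// exprSr mulrAC.
    by rewrite ler_pM2r.
  move/nat_eq_or_succ; apply; rewrite -doubleS.
  rewrite -(ltr_nat R) -muln2 natrM (le_lt_trans h3)// exprSr mulrAC.
  by rewrite ltr_pM2r.
- move=> ->; rewrite subrr normr0 !mulr_ge0// exprn_ge0//.
- by move=> ij; rewrite ij in it *; exact: incr_le_weight.
Qed.

(** The inequality [(n + i).+1 <= n.+1 * i.+1] factors the term of scale [n] out of the chain,
    leaving a series whose sum does not depend on [n]. *)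
Lemma dyadic_floor_steps (n k : nat) (t : R) : 0 <= t ->
  `|f (dyadic_floor R (n + k) t) - f (dyadic_floor R n t)| <=
  A * W t * (n.+1%:R * r ^+ n) * (1 - r) ^- 2.
Proof.
move=> t0; apply: (@le_trans _ _ (A * W t * (n.+1%:R * r ^+ n) *
   \sum_(1 <= i < k.+1) (i.+1%:R * r ^+ i))); last first.
  rewrite ler_wpM2l// ?mulr_ge0 ?exprn_ge0//.
  apply: le_trans (sum_succ_geometric_le _ _ k.+1 r0 r1).
  by rewrite -(big_mkord xpredT (fun i => i.+1%:R * r ^+ i)) [leRHS]big_nat_recl//
    big_add1 /= lerDr mulr_ge0 ?exprn_ge0.
elim: k => [|k IH]; first by rewrite addn0 subrr normr0 big_geq// mulr0.
rewrite big_nat_recr//= mulrDr.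
rewrite -[X in f X - _](_ : dyadic_floor R (n + k).+1 t = _); last by rewrite addnS.
rewrite -(subrKA (f (dyadic_floor R (n + k) t))) addrC.
apply: (le_trans (ler_normD _ _)); apply: lerD => //.
apply: (le_trans (dyadic_floor_step _ _ t0)).
rewrite -[leRHS]mulrA; apply: ler_wpM2l; first by rewrite mulr_ge0.
rewrite mulrACA -exprD addnS; apply: ler_wpM2r; first exact: exprn_ge0.
by rewrite -natrM ler_nat mulSn -!addnS addnC leq_add2l leq_pmulr.
Qed.

(** The bound of [dyadic_floor_steps] is uniform in [k], and the floors tend to [t] inside the
    half-line on which [f] is continuous. *)
Lemma dyadic_floor_dist (n : nat) (t : R) : 0 <= t ->
  `|f t - f (dyadic_floor R n t)| <= A * W t * (n.+1%:R * r ^+ n) * (1 - r) ^- 2.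
Proof.
move=> t0; apply/ler_addgt0Pl => e e0.
have [d d0 fd] : exists2 d : R, 0 < d &
    forall x, 0 <= x -> `|t - x| < d -> `|f t - f x| < e.
  have /subspace_continuousP/(_ t t0)/cvgrPdist_lt/(_ _ e0) := cf.
  rewrite near_withinE => /nbhs_ballP[d /= d0 fd].
  by exists d => // x x0 tx; apply: fd.
have [m md] : exists m : nat, 2 ^- m < d.
  have : (2^-1 : R) ^+ n @[n --> \oo] --> (0 : R).
    by apply: cvg_expr; rewrite ger0_norm ?invf_lt1 ?ltr1n.
  move=> /cvgrPdist_lt /(_ _ d0) [m _ /(_ m (leqnn _))] /=.
  by rewrite sub0r normrN exprVn ger0_norm ?invr_ge0 ?exprn_ge0//; exists m.
have [/andP[x0 xt] tx] := dyadic_floor_itv _ (n + m) _ t0.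
rewrite -(subrKA (f (dyadic_floor R (n + m) t))).
apply: (le_trans (ler_normD _ _)); apply: lerD; last exact: dyadic_floor_steps.
apply/ltW/fd => //; rewrite ger0_norm ?subr_ge0//.
apply: le_lt_trans md; rewrite lerBlDl (le_trans (ltW tx))// lerD2l.
by rewrite lef_pV2 ?posrE ?exprn_gt0// ler_weXn2l ?ler1n// leq_addl.
Qed.

(** The path goes from [t] to its floor, then to the floor of [s], then to [s]; the floors are equal
    or adjacent because [t - s <= 2^-n]. The three legs obey the same bound, hence the 3. *)
Lemma chaining_incr_le (n : nat) (s t : R) : 0 <= s -> s <= t -> t <= s + 2 ^- n ->
  `|f t - f s| <= 3 * (1 - r) ^- 2 * A * W t * (n.+1%:R * r ^+ n).
Proof.
move=> s0 st ts; have t0 : 0 <= t by exact: le_trans st.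
have c0 : 0 <= n.+1%:R * r ^+ n by rewrite mulr_ge0 ?exprn_ge0.
have S1 : 1 <= (1 - r) ^- 2.
  by rewrite invf_ge1 ?exprn_gt0 ?subr_gt0// exprn_ile1 ?subr_ge0 ?gerBl ?(ltW r1).
have mid : `|f (dyadic_floor R n t) - f (dyadic_floor R n s)| <= A * W t * (n.+1%:R * r ^+ n).
  have e0 : 0 < 2 ^+ n :> R by rewrite exprn_gt0.
  have /andP[h1 h2] := truncn_itv (mulr_ge0 (ltW e0) s0).
  have /andP[h3 h4] := truncn_itv (mulr_ge0 (ltW e0) t0).
  have [/andP[/= _ +] _] := dyadic_floor_itv _ n _ t0.
  rewrite /dyadic_floor; move: h1 h2 h3 h4.
  set j := Num.truncn _; set i := Num.truncn _ => h1 h2 h3 h4 it.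
  have [|] : i = j \/ i = j.+1.
    have : (j < i.+1)%N.
      by rewrite -(ltr_nat R) (le_lt_trans h1)// (le_lt_trans _ h4)// ler_pM2l.
    move/nat_eq_or_succ; apply.
    have h5 : 2 ^+ n * t <= 2 ^+ n * s + 1.
      by rewrite -(ler_pM2l e0) mulrDr divff ?gt_eqF in ts.
    by rewrite -(ltr_nat R) (le_lt_trans h3)// (le_lt_trans h5)// -(natr1 j.+1) ltrD2r.
  - by move=> ->; rewrite subrr normr0 !mulr_ge0 ?exprn_ge0.
  - by move=> ij; rewrite ij in it *; exact: incr_le_weight.
have ft := dyadic_floor_dist n _ t0; have fs := dyadic_floor_dist n _ s0.
have Wst : A * W s * (n.+1%:R * r ^+ n) * (1 - r) ^- 2 <=
    A * W t * (n.+1%:R * r ^+ n) * (1 - r) ^- 2.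
  by rewrite ler_wpM2r ?(le_trans _ S1)// ler_wpM2r// ler_wpM2l// W_nd.
have Wt1 : A * W t * (n.+1%:R * r ^+ n) <= A * W t * (n.+1%:R * r ^+ n) * (1 - r) ^- 2.
  by rewrite ler_peMr ?mulr_ge0 ?exprn_ge0.
rewrite -(subrKA (f (dyadic_floor R n t))) -[X in _ + X](subrKA (f (dyadic_floor R n s))).
rewrite distrC in fs.
have := ler_normD (f t - f (dyadic_floor R n t))
  (f (dyadic_floor R n t) - f (dyadic_floor R n s) + (f (dyadic_floor R n s) - f s)).
have := ler_normD (f (dyadic_floor R n t) - f (dyadic_floor R n s)) (f (dyadic_floor R n s) - f s).
lra.
Qed.

End chaining.

(** * Simultaneous control of Gaussian variables *)

(** Equal to [1/(n+1) - 1/(n+2)], so the total mass is at most 1, while the decay is slow enough for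
    [- ln] of a weight to grow only logarithmically. *)
Definition telescopic_weight (R : realType) (n : nat) : R := (n.+1%:R * n.+2%:R)^-1.

Lemma telescopic_weight_gt0 (R : realType) (n : nat) : 0 < telescopic_weight R n.
Proof. by rewrite invr_gt0 mulr_gt0. Qed.

Lemma sum_telescopic_weight_le1 (R : realType) (N : nat) :
  \sum_(0 <= i < N) telescopic_weight R i <= 1.
Proof.
have -> : \sum_(0 <= i < N) telescopic_weight R i = 1 - N.+1%:R^-1.
  elim: N => [|N IH]; first by rewrite big_geq// invr1 subrr.
  rewrite big_nat_recr//= IH /telescopic_weight.
  have e1 : N.+1%:R != 0 :> R by rewrite pnatr_eq0.
  have e2 : N.+2%:R != 0 :> R by rewrite pnatr_eq0.
  move: e1 e2; rewrite -(natr1 N.+1); move: N.+1%:R => x x0 x1.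
  by field; rewrite x0 x1.
by rewrite gerBl invr_ge0.
Qed.

Section weighted_series.
Context d (T : measurableType d) (R : realType) (P : {measure set T -> \bar R}).
Variable f : nat -> T -> \bar R.
Hypothesis f0 : forall n w, (0 <= f n w)%E.
Hypothesis mf : forall n, measurable_fun setT (f n).

Definition weighted_series (w : T) : \bar R :=
  (\sum_(n <oo) (telescopic_weight R n)%:E * f n w)%E.

Let g0 n w : (0 <= (telescopic_weight R n)%:E * f n w)%E.
Proof. by rewrite mule_ge0// lee_fin ltW// telescopic_weight_gt0. Qed.

Let mg n : measurable_fun setT (fun w => (telescopic_weight R n)%:E * f n w)%E.
Proof. by apply: measurable_funeM. Qed.

Lemma weighted_series_ge0 w : (0 <= weighted_series w)%E.
Proof. exact: nneseries_ge0. Qed.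

Lemma measurable_weighted_series : measurable_fun setT weighted_series.
Proof. by apply: ge0_emeasurable_sum. Qed.

Lemma le_weighted_series n w : ((telescopic_weight R n)%:E * f n w <= weighted_series w)%E.
Proof.
apply: le_trans (nneseries_lim_ge n.+1 (fun n _ _ => g0 n w)).
by rewrite big_nat_recr//= leeDr// sume_ge0.
Qed.

Lemma integral_weighted_series_le (B : R) : 0 <= B ->
  (forall n, \int[P]_w f n w <= B%:E)%E -> (\int[P]_w weighted_series w <= B%:E)%E.
Proof.
move=> B0 fB; rewrite integral_nneseries//.
apply: lime_le; first by apply: is_cvg_nneseries => n _ _; exact: integral_ge0.
near=> N; apply: (@le_trans _ _ (\sum_(0 <= i < N) (telescopic_weight R i * B)%:E)%E).
  apply: lee_sum => i _; rewrite ge0_integralZl//= ?lee_fin ?EFinM; last first.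
    exact/ltW/telescopic_weight_gt0.
  by apply: lee_wpmul2l => //; rewrite lee_fin ltW// telescopic_weight_gt0.
rewrite sumEFin lee_fin -mulr_suml ler_piMl//.
exact: sum_telescopic_weight_le1.
Unshelve. all: by end_near. Qed.

End weighted_series.

(* [eta^2 = 1 + ln (1 + Z)] for the doubly weighted series [Z] of the [exp ((X n j)^2)]. *)
Lemma sup_gaussian_control d (T : measurableType d) (R : realType)
    (P : probability T R) (X : nat -> nat -> T -> R) :
  (forall n j, measurable_fun setT (X n j)) ->
  (forall n j, (\int[P]_w (expR (X n j w ^+ 2))%:E <= 2%:E)%E) ->
  exists eta : T -> R, [/\ measurable_fun setT eta, forall w, 1 <= eta w,
    {ae P, forall w, forall n j, X n j w ^+ 2 <=
       eta w ^+ 2 - ln (telescopic_weight R n) - ln (telescopic_weight R j)} &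
    forall u, 0 < u ->
      (P [set w | (u < eta w)%R] <= (3 * expR 1 * expR (- u ^+ 2))%:E)%E].
Proof.
move=> mX EX.
pose g n j w := (expR (X n j w ^+ 2))%:E.
have g0 n j w : (0 <= g n j w)%E by rewrite lee_fin expR_ge0.
have mg n j : measurable_fun setT (g n j).
  by apply/measurable_EFinP/measurableT_comp => //; exact: measurable_funX.
pose Zn n := weighted_series _ _ R (g n).
have Zn0 n w : (0 <= Zn n w)%E by exact: weighted_series_ge0.
have mZn n : measurable_fun setT (Zn n) by exact: measurable_weighted_series.
pose Z := weighted_series _ _ R Zn.
have Z0 w : (0 <= Z w)%E by exact: weighted_series_ge0.
have mZ : measurable_fun setT Z by exact: measurable_weighted_series.
have EZ : (\int[P]_w Z w <= 2%:E)%E.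
  apply: integral_weighted_series_le => // n.
  exact: (@integral_weighted_series_le _ _ _ P (g n) (g0 n) (mg n) 2 _ (EX n)).
have iZ : P.-integrable setT Z.
  apply/integrableP; split => //; under eq_integral do rewrite gee0_abs//.
  exact: (le_lt_trans EZ (ltry _)).
(* On the null set where [Z] is infinite, [fine] returns 0, so that [eta] is a real number
   everywhere. *)
pose z w := fine (Z w).
have z0 w : 0 <= z w by rewrite fine_ge0.
have mz : measurable_fun setT z by exact: measurableT_comp.
have Ez : (\int[P]_w (1 + z w)%:E <= 3%:E)%E.
  under eq_integral do rewrite EFinD.
  rewrite ge0_integralD//=; last 2 first.
  - by move=> w _; rewrite lee_fin.
  - exact/measurable_EFinP.
  rewrite integral_cst//= probability_setT mule1.
  rewrite (_ : 3%:E = 1%:E + 2%:E)%E; last by rewrite -EFinD; congr EFin; lra.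
  apply: leeD => //; apply: le_trans EZ; apply: ge0_le_integral => //=.
  - by move=> w _; rewrite lee_fin.
  - exact/measurable_EFinP.
  - move=> w _; rewrite /z; case: (Z w) (Z0 w) => //= _; exact: leey.
(* The outer 1 gives [eta >= 1], which later lets additive constants be absorbed into [eta]. *)
pose L w := 1 + ln (1 + z w).
have L1 w : 1 <= L w by rewrite lerDl ln_ge0// lerDl.
have L0 w : 0 <= L w by rewrite (le_trans _ (L1 w)).
have meta : measurable_fun setT (fun w => Num.sqrt (L w)).
  apply: (measurableT_comp (continuous_measurable_fun (@sqrt_continuous R))).
  apply: measurable_funD => //; apply: (measurableT_comp (@measurable_ln R)).
  exact: measurable_funD.
exists (fun w => Num.sqrt (L w)); split => //.
- by move=> w; rewrite -[leLHS]sqrtr1 ler_wsqrtr.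
- have := integrable_ae measurableT iZ; apply: filterS => w /(_ I) Zfin n j.
  have an := telescopic_weight_gt0 R n; have aj := telescopic_weight_gt0 R j.
  (* One term of a nonnegative series is at most its sum; taking logarithms gives the bound on
     [X n j]. *)
  have : telescopic_weight R n * (telescopic_weight R j * expR (X n j w ^+ 2)) <= 1 + z w.
    apply: (@le_trans _ _ (z w)); last by rewrite lerDr.
    rewrite -lee_fin /z fineK//; apply: le_trans (le_weighted_series _ _ _ _ Zn0 n w).
    rewrite EFinM; apply: lee_wpmul2l; first by rewrite lee_fin ltW.
    by rewrite EFinM; exact: le_weighted_series.
  rewrite -ler_ln ?posrE ?ltr_wpDr// ?mulr_gt0 ?expR_gt0//.
  rewrite lnM ?posrE ?mulr_gt0 ?expR_gt0// lnM ?posrE ?expR_gt0// expRK.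
  by rewrite sqr_sqrtr// /L; lra.
(* Markov's inequality for [1 + z], of expectation at most 3: the event [u < eta] forces
   [1 + z > exp (u^2 - 1)]. *)
- move=> u u0; pose c := expR (u ^+ 2 - 1).
  have c0 : 0 < c by exact: expR_gt0.
  have mA : measurable [set w | c < 1 + z w].
    rewrite -[X in measurable X]setTI; apply: measurable_fun_ltr => //.
    exact: measurable_funD.
  have sub : [set w | u < Num.sqrt (L w)] `<=` [set w | c < 1 + z w].
    move=> w /= uL; have : u ^+ 2 < L w.
      by rewrite -[ltRHS]sqr_sqrtr// ltrXn2r ?nnegrE// ?ltW.
    by move=> uL2; rewrite -ltr_ln ?posrE ?ltr_wpDr// expRK; move: uL2; rewrite /L; lra.
  have : (c%:E * P [set w | (c < 1 + z w)%R] <= 3%:E)%E.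
    apply: le_trans Ez.
    rewrite -(setIT [set w | _]) -integral_indic// -ge0_integralZl//=; last 2 first.
      exact/measurable_EFinP.
      by rewrite lee_fin ltW.
    apply: ge0_le_integral => //=.
    - by move=> w _; rewrite mule_ge0// lee_fin ?ltW.
    - apply/(@measurable_EFinP _ _ _ _ (fun w => c * \1_[set w | c < 1 + z w] w)).
      exact: measurable_funM.
    - by apply/measurable_EFinP; exact: measurable_funD.
    - move=> w _; rewrite -EFinM lee_fin indicE; have [wA|_] := boolP (w \in _).
        by rewrite mulr1 ltW//; move: wA; rewrite inE.
      by rewrite mulr0 addr_ge0.
  have mu : measurable [set w | u < Num.sqrt (L w)].
    rewrite -[X in measurable X]setTI; apply: measurable_fun_ltr => //.
  have PA := le_measure P (mem_set mu) (mem_set mA) sub.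
  have [q Pq] : exists q, P [set w | c < 1 + z w] = q%:E.
    by exists (fine (P [set w | c < 1 + z w])); rewrite fineK// fin_num_measure.
  rewrite Pq -EFinM lee_fin => cA.
  apply: (@le_trans _ _ q%:E); first by rewrite -Pq.
  rewrite lee_fin -mulrA -expRD (_ : 1 + - u ^+ 2 = - (u ^+ 2 - 1)); last by ring.
  by rewrite expRN ler_pdivlMr// mulrC.
Qed.

(** * The modulus of continuity *)

Lemma ln_le_succ (R : realType) (n : nat) : ln n.+1%:R <= n%:R :> R.
Proof. by rewrite -natr1 addrC le_ln1Dx// (lt_le_trans (ltrN10 _)). Qed.

Lemma ln_le_powR (R : realType) (m g : R) : 1 <= m -> 0 < g -> ln m <= (2 * g)^-1 * (m `^ g) ^+ 2.
Proof.
move=> m1 g0; have m0 : 0 < m by exact: lt_le_trans m1.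
rewrite -powR_mulrn ?powR_ge0// -powRrM mulrC ler_pdivlMr ?mulr_gt0//.
have := ln_sublinear (powR_gt0 (2 * g) m0); rewrite ln_powR mulrC [g * _]mulrC; exact: ltW.
Qed.

(** The cost of the weights. With [m] the maximum on the right, [j+1 <= 2^n m] gives
    [ln (j+1) <= n + ln m]; the terms in [n] go into [n.+1] and [ln m] into a small power of [m]. *)
Lemma ln_telescopic_weight_le (R : realType) (g : R) (n j : nat) : 0 < g ->
  - ln (telescopic_weight R n) - ln (telescopic_weight R j) <=
  (6 + g^-1) * (n.+1%:R * Num.max (j.+1%:R / 2 ^+ n) 1 `^ g) ^+ 2.
Proof.
move=> g0; set m := Num.max _ _; have e0 : 0 < 2 ^+ n :> R by rewrite exprn_gt0.
have m1 : 1 <= m by rewrite le_max lexx orbT.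
have m0 : 0 < m by exact: lt_le_trans m1.
have lnw k : - ln (telescopic_weight R k) = ln k.+1%:R + ln k.+2%:R.
  by rewrite /telescopic_weight lnV ?posrE ?mulr_gt0// opprK lnM ?posrE.
have ln2 : ln 2 <= 1 :> R by exact: (ln_le_succ R 1).
have lnj : ln j.+1%:R <= n%:R + ln m.
  apply: (@le_trans _ _ (ln (2 ^+ n * m))).
    by rewrite ler_ln ?posrE ?mulr_gt0// mulrC -ler_pdivrMr// le_max lexx.
  by rewrite lnM ?posrE// lerD2r lnXn// -[ln 2 *+ n]mulr_natl ler_piMr.
have lnj1 : ln j.+2%:R <= 1 + ln j.+1%:R :> R.
  apply: (@le_trans _ _ (ln (2 * j.+1%:R))).
    by rewrite ler_ln ?posrE ?mulr_gt0// -natrM ler_nat mul2n -addnn addSn addnS !ltnS leq_addr.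
  by rewrite lnM ?posrE// lerD2r.
have lnn := ln_le_succ R n; have lnn1 := ln_le_succ R n.+1.
have lnm := ln_le_powR _ _ _ m1 g0.
have mg1 : 1 <= m `^ g by rewrite -[leLHS](powRr0 m) ler_powR// ltW.
have n1 : 1 <= n.+1%:R :> R by rewrite ler1n.
rewrite !lnw exprMn; rewrite -(natr1 n) in lnn lnn1 n1 *; rewrite invfM -mulrA in lnm.
set x := (m `^ g) ^+ 2 in lnm *; have x1 : 1 <= x by rewrite exprn_ege1.
set N := n%:R in lnj lnn lnn1 n1 *.
have N2 : N + 1 <= (N + 1) ^+ 2 by rewrite ler_eXnr.
have N21 : 1 <= (N + 1) ^+ 2 by rewrite exprn_ege1.
have gi : 0 < g^-1 by rewrite invr_gt0.
apply: (@le_trans _ _ (6 * (N + 1) + g^-1 * x)); first lra.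
have := ler_wpM2l (le_trans ler01 N21) x1.
have : g^-1 * x <= g^-1 * ((N + 1) ^+ 2 * x) by rewrite ler_pM2l// ler_peMl// (le_trans _ x1).
lra.
Qed.

Lemma dyadic_scale (R : realType) (d : R) : 0 < d -> d <= 1 ->
  exists n : nat, 2 ^- n.+1 < d /\ d <= 2 ^- n.
Proof.
move=> d0 d1; have ex : exists n : nat, 2 ^- n < d.
  have : (2^-1 : R) ^+ n @[n --> \oo] --> (0 : R).
    by apply: cvg_expr; rewrite ger0_norm ?invf_lt1 ?ltr1n.
  move=> /cvgrPdist_lt /(_ _ d0) [m _ /(_ m (leqnn _))] /=.
  by rewrite sub0r normrN exprVn ger0_norm ?invr_ge0 ?exprn_ge0//; exists m.
(* The least [n] with [2^-n < d] is positive since [d <= 1]; its predecessor is the required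
   scale. *)
case: (ex_minnP ex) => -[|n] nd min; first by move: nd; rewrite expr0 invr1 ltNge d1.
exists n; split => //; rewrite leNgt; apply/negP => /min; by rewrite ltnn.
Qed.

(** From [ln 2 >= 1/2], [n <= 2 |ln d|]; both [|ln d|] and 1 are at most the maximum, hence the
    3. *)
Lemma succ_le_ln_powR (R : realType) (n : nat) (d p : R) : 0 < d -> d <= 2 ^- n -> 1 <= p ->
  n.+1%:R <= 3 * Num.max (`|ln d| `^ p) 1.
Proof.
move=> d0 dn p1; set M := Num.max _ _.
have M1 : 1 <= M by rewrite le_max lexx orbT.
have lM : `|ln d| <= M.
  have [l1|l1] := leP `|ln d| 1; first exact: le_trans M1.
  by rewrite le_max le1r_powR// ltW.
have ln2 : 2^-1 <= ln 2 :> R.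
  have : ln (1 + - 2^-1) <= - 2^-1 :> R by apply: le_ln1Dx; lra.
  rewrite (_ : 1 + - 2^-1 = 2^-1); last by field.
  by rewrite lnV ?posrE//; lra.
have : ln d <= - (n%:R * ln 2).
  rewrite mulr_natl -lnXn// -lnV ?posrE ?exprn_gt0// ler_ln ?posrE// invr_gt0 exprn_gt0//.
have := ler_norm (- ln d); rewrite normrN => h h2.
have n0 : 0 <= n%:R :> R by [].
rewrite -natr1; nra.
Qed.

Lemma weight_max_powR (R : realType) (q t : R) : 0 <= q -> 0 <= t ->
  Num.max t 1 `^ q <= Num.max (t `^ q) 1.
Proof.
move=> q0 t0; have [t1|t1] := leP t 1; first by rewrite powR1 le_max lexx orbT.
by rewrite le_max lexx.
Qed.

Theorem theorem9 (d : measure_display) (T : measurableType d) (R : realType)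
  (P : probability T R) (H : R -> R) (Y : R -> T -> R)
  (h1 h2 D kappa : R) :
  {within [set t : R | 0 <= t], continuous H} ->
  (forall t, 0 <= t -> 0 < H t < 1) ->
  0 < h1 -> h1 < h2 -> h2 < 1 ->
  (forall t, 0 <= t -> h1 <= H t <= h2) ->
  0 < D -> 0 < kappa -> kappa <= 1 ->
  (forall t s, 0 < s -> s <= t -> `|H t - H s| <= D * (t - s) `^ kappa) ->
  is_harmonizable_mBm P H Y ->
  let h3 := Num.min h1 kappa in
  forall eps p : R, 0 < eps -> 2 < p ->
  exists eta : T -> R,
    measurable_fun setT eta /\ (forall w, 0 <= eta w) /\
    {ae P, forall w, forall t1 t2 : R, 0 <= t2 -> t2 < t1 -> t1 <= t2 + 1 ->
       `|Y t1 w - Y t2 w| <=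
         Num.max (t1 `^ (h2 + eps)) 1 * (t1 - t2) `^ h3 *
         Num.max (`|ln (t1 - t2)| `^ p) 1 * eta w} /\
    exists C1 C2 : R, 0 < C1 /\ 0 < C2 /\
      forall u : R, 0 < u ->
        (P [set w | (u < eta w)%R] <= (C1 * expR (- (C2 * u ^+ 2)))%:E)%E.
Proof.
move=> cH H01 h10 h12 h21 Hh D0 k0 k1 HD YP h3 eps p eps0 p2.
have [e [e0 eeps eh1 h2e]] : exists e : R, [/\ 0 < e, e < eps, e < h1 & h2 + e < 1].
  (* Half the smallest of the three margins. *)
  exists (Num.min eps (Num.min h1 (1 - h2)) / 2).
  have m1 : Num.min eps (Num.min h1 (1 - h2)) <= eps by rewrite ge_min lexx.
  have m2 : Num.min eps (Num.min h1 (1 - h2)) <= h1 by rewrite !ge_min lexx orbT.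
  have m3 : Num.min eps (Num.min h1 (1 - h2)) <= 1 - h2 by rewrite !ge_min lexx !orbT.
  have : 0 < Num.min eps (Num.min h1 (1 - h2)) by rewrite !lt_min eps0 h10 subr_gt0.
  by split; lra.
(* The exponent [eps] is shared: [e] is spent on the variance bound, [g] on the position weights. *)
pose g := eps - e; have g0 : 0 < g by rewrite subr_gt0.
have gi0 : 0 < g^-1 by rewrite invr_gt0.
have [C C0 VC] := mbm_incr_sqr_le _ _ _ _ _ _ _ _ _ _ _ YP Hh k0 HD e0 eh1 h2e.
have h30 : 0 < h3 by rewrite lt_min h10.
pose tt (n j : nat) : R := j%:R / 2 ^+ n.
have tt0 n j : 0 <= tt n j by rewrite divr_ge0 ?exprn_ge0.
have ttB n j : tt n j.+1 - tt n j = 2 ^- n by rewrite -mulrBl -natr1 addrAC subrr add0r mul1r.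
have i2n n : 0 < 2 ^- n :> R by rewrite invr_gt0 exprn_gt0.
pose m n j : R := Num.max (tt n j.+1) 1.
have m0 n j : 0 < m n j by rewrite lt_max ltr01 orbT.
pose v n j := m n j `^ (h2 + e) * (2 ^- n) `^ h3.
have v0 n j : 0 < v n j by rewrite mulr_gt0 ?powR_gt0.
(* Dyadic increments scaled by their variance bound [C * v^2]; the 8 is the one of
   [gaussian_expR_sqr]. *)
pose X n j w := (Y (tt n j.+1) w - Y (tt n j) w) / Num.sqrt (8 * (C * v n j ^+ 2)).
have V0 n j : 0 < C * v n j ^+ 2 by rewrite mulr_gt0 ?exprn_gt0.
have V80 n j : 0 < 8 * (C * v n j ^+ 2) by exact: mulr_gt0 (V0 n j).
have X2 n j w : X n j w ^+ 2 = (Y (tt n j.+1) w - Y (tt n j) w) ^+ 2 / (8 * (C * v n j ^+ 2)).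
  by rewrite exprMn exprVn sqr_sqrtr// ltW// mulr_gt0.
have mX n j : measurable_fun setT (X n j).
  by apply: measurable_funM => //; apply: measurable_funB; exact: mbm_measurable YP _.
have EX n j : (\int[P]_w (expR (X n j w ^+ 2))%:E <= 2%:E)%E.
  under eq_integral do rewrite X2.
  apply: gaussian_expR_sqr => //; first exact: mbm_incr_gaussian YP _ _.
  rewrite /v -(ttB n j); apply: VC => //.
    by rewrite -subr_gt0 ttB.
  by rewrite -lerBlDl ttB invf_le1 ?exprn_gt0// exprn_ege1// ler1n.
have [eta [meta eta1 eta_ae eta_tail]] := sup_gaussian_control _ _ _ _ _ mX EX.
have eta0 w : 0 <= eta w by exact: le_trans (eta1 w).
pose r : R := 2 `^ (- h3).
have r0 : 0 < r by rewrite powR_gt0.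
have r1 : r < 1.
  rewrite /r powRN invf_lt1 ?powR_gt0// -[ltLHS](powRr0 2) /powR gt_eqF// ltr_expR.
  by rewrite mul0r mulr_gt0// ln_gt0// ltr1n.
have rn n : (2 ^- n) `^ h3 = r ^+ n.
  rewrite -powR_invn// -powRrM -powR_mulrn ?(ltW r0)// -powRrM; congr (_ `^ _); ring.
pose S := (1 - r) ^- 2.
have S0 : 0 < S by rewrite invr_gt0 exprn_gt0// subr_gt0.
(* [8 * C] undoes the scaling of [X]; 7 is the 6 of [ln_telescopic_weight_le] plus 1 for the term
   [eta^2]. *)
pose c := Num.sqrt (8 * C * (7 + g^-1)).
have c0 : 0 < c by rewrite sqrtr_gt0 !mulr_gt0// addr_gt0.
pose W t : R := Num.max (t `^ (h2 + eps)) 1.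
have W0 t : 0 <= W t by rewrite le_max ler01 orbT.
have W_nd s t : 0 <= s -> s <= t -> W s <= W t.
  move=> s0 st; rewrite ge_max !le_max lexx orbT andbT.
  have q0 : 0 <= h2 + eps by lra.
  by rewrite (ge0_ler_powR q0) ?nnegrE ?(le_trans s0).
have incr w : (forall n j, X n j w ^+ 2 <=
       eta w ^+ 2 - ln (telescopic_weight R n) - ln (telescopic_weight R j)) ->
    forall n j : nat, `|Y (j.+1%:R / 2 ^+ n) w - Y (j%:R / 2 ^+ n) w| <=
      c * eta w * W (j.+1%:R / 2 ^+ n) * (n.+1%:R * r ^+ n).
  move=> Xle n j.
  have hX := Xle n j; have hl := ln_telescopic_weight_le _ g n j g0.
  rewrite -/(tt n j.+1) -/(m n j) in hl; rewrite -/(tt n j.+1) -/(tt n j).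
  set y := n.+1%:R * m n j `^ g in hl.
  have m1 : 1 <= m n j by rewrite le_max lexx orbT.
  have y1 : 1 <= y.
    by rewrite mulr_ege1 ?ler1n// -[leLHS](powRr0 (m n j)) ler_powR// ltW.
  (* Since [eta] and [y] are at least 1, the sum of their squares with coefficients is bounded by
     their squared product. *)
  have {hl}hX2 : X n j w ^+ 2 <= (7 + g^-1) * (eta w * y) ^+ 2.
    rewrite [in leRHS]exprMn; have y21 : 1 <= y ^+ 2 by rewrite exprn_ege1.
    have e21 : 1 <= eta w ^+ 2 by rewrite exprn_ege1.
    have a1 : eta w ^+ 2 <= eta w ^+ 2 * y ^+ 2 by rewrite ler_peMr ?sqr_ge0.
    have a2 : (6 + g^-1) * y ^+ 2 <= (6 + g^-1) * (eta w ^+ 2 * y ^+ 2).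
      by rewrite ler_pM2l ?addr_gt0// ler_peMl ?sqr_ge0.
    lra.
  (* The exponents [h2 + e] and [g] recombine into [h2 + eps]. *)
  have vy : v n j * y = m n j `^ (h2 + eps) * (n.+1%:R * r ^+ n).
    rewrite /v /y rn (_ : h2 + eps = (h2 + e) + g); last by rewrite /g; ring.
    by rewrite [in RHS]powRD ?(gt_eqF (m0 _ _)) ?implybT//; ring.
  apply: (@le_trans _ _ (c * eta w * (v n j * y))); last first.
    rewrite vy [leLHS]mulrA ler_wpM2r ?mulr_ge0 ?exprn_ge0 ?(ltW r0)//.
    rewrite ler_wpM2l ?mulr_ge0 ?(ltW c0)//.
    by apply: weight_max_powR => //; apply: addr_ge0; apply: ltW => //; exact: lt_trans h12.
  have B0 : 0 <= c * eta w * (v n j * y).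
    by apply: mulr_ge0; apply: mulr_ge0 => //; [exact: ltW|exact: ltW|exact: le_trans y1].
  rewrite -ler_sqr ?nnegrE//.
  rewrite real_normK ?num_real//.
  move: hX2; rewrite X2 (ler_pdivrMr _ _ (V80 n j)) => /le_trans; apply.
  rewrite !exprMn sqr_sqrtr; last by rewrite !mulr_ge0 ?addr_ge0 ?ltW.
  by rewrite le_eqVlt; apply/orP; left; apply/eqP; ring.
(* The 9 is 3 from chaining times 3 from [succ_le_ln_powR]. The division by [r] pays for one scale:
   only [2^-(n+1)], not [2^-n], lies below [t1 - t2]. *)
pose K := 9 * S * c / r.
have K0 : 0 < K by rewrite !mulr_gt0// invr_gt0.
exists (fun w => K * eta w); split; first exact: measurable_funM.
split; first by move=> w; rewrite mulr_ge0// ltW.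
split; last first.
  (* The tail of [eta] at [u / K] yields the rate [1/K^2]. *)
  exists (3 * expR 1), (K ^- 2); split; first by rewrite mulr_gt0 ?expR_gt0.
  split; first by rewrite invr_gt0 exprn_gt0.
  move=> u u0; have := eta_tail (u / K) (divr_gt0 u0 K0).
  rewrite [(u / K) ^+ 2]exprMn exprVn [u ^+ 2 * _]mulrC.
  by under eq_set do rewrite ltr_pdivrMr// mulrC.
have [_ [_ Yc]] := YP.
apply: filterS2 eta_ae Yc => w Xle cY t1 t2 t20 t21 t12.
have d0 : 0 < t1 - t2 by rewrite subr_gt0.
have d1 : t1 - t2 <= 1 by lra.
have [n [nd dn]] := dyadic_scale _ _ d0 d1.
have t10 : 0 <= t1 by lra.
have cA : 0 <= c * eta w by exact: mulr_ge0 (ltW c0) (eta0 w).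
have := chaining_incr_le _ (fun t => Y t w) W _ r cY cA (ltW r0) r1 W0 W_nd
  (incr w Xle) n t2 t1 t20 (ltW t21).
rewrite -lerBlDl => /(_ dn) /le_trans; apply.
have pn : n.+1%:R <= 3 * Num.max (`|ln (t1 - t2)| `^ p) 1 by apply: succ_le_ln_powR dn _ => //; lra.
have rd : r ^+ n <= (t1 - t2) `^ h3 / r.
  rewrite ler_pdivlMr// -exprSr -rn; apply: ge0_ler_powR => //; rewrite ?nnegrE ?ltW//.
rewrite -/S -/(W t1).
set M := Num.max _ 1 in pn *; set dh := (t1 - t2) `^ h3 in rd *.
have : n.+1%:R * r ^+ n <= 3 * M * (dh / r) by apply: ler_pM; rewrite ?exprn_ge0 ?(ltW r0).
have : 0 <= 3 * S * (c * eta w) * W t1 by rewrite !mulr_ge0 ?(ltW S0) ?(ltW c0).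
move=> /ler_wpM2l/[apply] /le_trans; apply.
rewrite /K le_eqVlt; apply/orP; left; apply/eqP; ring.
Qed.
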